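(* Let $k \ge 3$ and $n$ be integers and let $I$ be a coclique (independent set) in the graph $J(n,k,\{1\})$ of size $|I| = \binom{n-2}{k-2}$. (1) If $3k-3 < n < k^2-k+1$, then $I$ is a 2-star. (2) If $n = 3k-3$, then $I$ is either a 2-star or the family $\{S \in \binom{[n]}{k} : |S\cap T| \ge 3\}$ of all $k$-sets having at least 3 elements in common with $T$, for some fixed 4-element set $T \subset [n]$.
   Context: Here $[n]=\{1,\ldots,n\}$ and $\binom{[n]}{k}$ is the collection of all $k$-element subsets of $[n]$. The graph $J(n,k,\{1\})$ is the simple graph with vertex set $\binom{[n]}{k}$ in which two vertices are adjacent if and only if the corresponding distinct $k$-sets intersect in exactly one element. A 2-star is the family of all $k$-element subsets of $[n]$ containing a fixed 2-element subset of $[n]$. *)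

(* Defs.v *)
From mathcomp Require Import all_boot.

Set Implicit Arguments.
Unset Strict Implicit.
Unset Printing Implicit Defensive.

(* MathComp; the ground set {1, ..., n} is rendered as 'I_n. *)
Definition kset (n k : nat) : finType := {S : {set 'I_n} | #|S| == k}.

Definition J1 (n k : nat) : rel (kset n k) :=
  fun S T => (S != T) && (#|val S :&: val T| == 1).

Lemma J1_sym (n k : nat) : symmetric (@J1 n k).
Proof. by move=> S T; rewrite /J1 eq_sym setIC. Qed.

Lemma J1_irrefl (n k : nat) : irreflexive (@J1 n k).
Proof. by move=> S; rewrite /J1 eqxx. Qed.

Definition coclique (V : finType) (e : rel V) (I : {set V}) : Prop :=
  {in I &, forall x y, ~~ e x y}.

Definition two_star (n k : nat) (I : {set kset n k}) : Prop :=
  exists2 A : {set 'I_n}, #|A| = 2 & I = [set S : kset n k | A \subset val S].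

Definition meets_in_three (n k : nat) (T : {set 'I_n}) : {set kset n k} :=
  [set S : kset n k | 3 <= #|val S :&: T|].

(* Main.v *)
Require Import Defs.
From mathcomp Require Import all_boot all_order all_algebra.
From mathcomp Require Import zify ring lra.

(** Write n = 2k + e.  On functions on k-sets consider the symmetric operator
    [theta I + (e+1) A_1 - w A_0 - c J], where A_j joins the pairs of k-sets
    meeting in j points and the coefficients are chosen so that the eigenvalues
    on the first three Johnson eigenspaces vanish.  For n >= 3k-3 it is positive
    semidefinite, and w > 0 exactly when n < k^2-k+1.  Evaluating it on the
    indicator of a coclique F gives |F| <= C(n-2,k-2); in case of equality F
    has no disjoint pairs, hence is 2-intersecting, and the indicator lies in
    the kernel, which says that every k-set S outside F that is met by all
    members of F is met in exactly one point by C(n-k-1,k-2) of them.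

    Apply this to S = A - s + y when F is compressed, A is in F, S is not, and s
    is the largest element for which such A and y exist.  If A contains i
    elements below s and misses u of them, the count forces 2^u <= i, and for
    the members of F counted it forces 2^(i-1) <= u+1.  So (u,i) is (0,1) or
    (1,2), giving the 2-star and the family |S & T| >= 3 with |T| = 4; the
    second one needs n = 3k-3.  Finally, each shift that compresses F can be
    undone: the sets on which F and its shift may differ are connected by the
    relation |U & W| = 2, so they all move or all stay. *)

Set Implicit Arguments.
Unset Strict Implicit.
Unset Printing Implicit Defensive.

Import Order.TTheory GRing.Theory Num.Theory.

(** * Set families and a basic count *)

Definition uniform (T : finType) (k : nat) (F : {set {set T}}) : Prop :=
  {in F, forall A : {set T}, #|A| = k}.

Definition two_intersecting (T : finType) (F : {set {set T}}) : Prop :=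
  {in F &, forall A B : {set T}, 2 <= #|A :&: B|}.

(** Complementation in [S] yields subsets of [S :\: R]. The lower index [#|S| - r] stays right for
    [r < #|R|], where the value is 0; a truncated [r - #|R|] would give 1. *)
Lemma card_between (T : finType) (R S : {set T}) (r : nat) :
  r <= #|S| -> R \subset S ->
  #|[set X : {set T} | [&& R \subset X, X \subset S & #|X| == r]]|
    = 'C(#|S| - #|R|, #|S| - r).
Proof.
move=> rS RS.
have cD : #|S :\: R| = #|S| - #|R| by rewrite cardsD (setIidPr RS).
rewrite -cD -cards_draws -(card_in_imset (f := fun X => S :\: X)); last first.
  move=> X Y; rewrite !inE => /and3P[_ XS _] /and3P[_ YS _] e.
  have sDD (Z : {set T}) : Z \subset S -> Z = S :\: (S :\: Z).
    by move=> ZS; rewrite setDDr setDv set0U (setIidPr ZS).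
  by rewrite (sDD X) // e -sDD.
apply: eq_card => Z; rewrite !inE; apply/imsetP/andP.
  case=> X; rewrite !inE => /and3P[RX XS /eqP cX] ->; split.
    by rewrite setDS.
  by rewrite cardsD (setIidPr XS) cX.
case=> ZS /eqP cZ; exists (S :\: Z).
  have ZS' : Z \subset S by apply: subset_trans ZS (subsetDl _ _).
  rewrite !inE subsetDl cardsD (setIidPr ZS') cZ subKn // eqxx andbT andbT.
  rewrite subsetD RS /=; rewrite -setI_eq0; apply/eqP/setP => x; rewrite !inE.
  by apply/negP => /andP[xR xZ]; move/subsetP/(_ x xZ): ZS; rewrite !inE xR.
have ZS' : Z \subset S by apply: subset_trans ZS (subsetDl _ _).
by rewrite setDDr setDv set0U (setIidPr ZS').
Qed.

(** * Harmonic functions on slices *)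

Local Open Scope ring_scope.

(* For a function on i-sets the condition at Q is void unless |Q| = i - 1. *)
Definition harmonic (T : finType) (i : nat) (h : {set T} -> rat) : Prop :=
  (forall R : {set T}, #|R| != i -> h R = 0) /\
  (forall Q : {set T}, \sum_(y | y \notin Q) h (y |: Q) = 0).

Definition layer (T : finType) (h : {set T} -> rat) (j : nat) (S : {set T}) : rat :=
  \sum_(R : {set T} | #|R :&: S| == j) h R.

(** For [h] harmonic of degree i, its restriction to k-sets lies in the i-th eigenspace of the
    Johnson scheme. *)
Definition zeta (T : finType) (h : {set T} -> rat) (S : {set T}) : rat :=
  \sum_(R : {set T} | R \subset S) h R.

Lemma sumr_const_pred (I : finType) (P : pred I) (a : rat) :
  \sum_(i | P i) a = #|P|%:R * a.
Proof. by rewrite sumr_const mulr_natl. Qed.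

Lemma sum_setU1 (T : finType) (y : T) (P : pred {set T}) (f : {set T} -> rat) :
  \sum_(Q : {set T} | (y \notin Q) && P Q) f (y |: Q)
  = \sum_(R : {set T} | (y \in R) && P (R :\ y)) f R.
Proof.
rewrite [RHS](reindex_onto (fun Q => y |: Q) (fun R => R :\ y)) /=; last first.
  by move=> R /andP[yR _]; rewrite setD1K.
apply: eq_bigl => Q; rewrite setU11 /=.
case yQ: (y \in Q) => /=; last by rewrite setU1K ?yQ // eqxx andbT.
apply/esym/negP => /andP[_ /eqP e].
by move: yQ; rewrite -e !inE eqxx.
Qed.

(** Sum the harmonic condition over all [Q] meeting [S] in j points. A set [R] arises as [y |: Q]
    from each of its i - j elements outside [S] if it meets [S] in j points, and from each of its j
    + 1 elements inside if it meets [S] in j + 1. *)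
Lemma layer_step (T : finType) (i : nat) (h : {set T} -> rat) (j : nat) (S : {set T}) :
  harmonic i h ->
  (i%:R - j%:R) * layer h j S + j.+1%:R * layer h j.+1 S = 0.
Proof.
case=> hs hh.
have cnt (R : {set T}) : \sum_(y | (y \in R) && (#|(R :\ y) :&: S| == j)) h R =
  (if #|R :&: S| == j then (i%:R - j%:R) * h R else 0)
  + (if #|R :&: S| == j.+1 then j.+1%:R * h R else 0).
  have [cR|/hs ->] := eqVneq #|R| i; last first.
    by rewrite big1 // !mulr0; do 2 case: ifP => _; rewrite addr0.
  have e y : y \in R -> (#|(R :\ y) :&: S| == j) = (#|R :&: S| == j + (y \in S))%N.
    move=> yR; rewrite (cardsD1 y (R :&: S)) inE yR /= addnC eqn_add2r.
    by congr (#|pred_of_set _| == j); apply/setP => x; rewrite !inE; case: eqP.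
  rewrite sumr_const_pred.
  have [c|nc] := eqVneq #|R :&: S| j.
    have -> : #|[pred y | (y \in R) && (#|(R :\ y) :&: S| == j)]| = #|R :\: S|.
      apply: eq_card => y; rewrite !inE andbC; case yR: (y \in R); last by rewrite !andbF.
      by rewrite e // c; case: (y \in S); lia.
    have -> : (#|R :&: S| == j.+1) = false by lia.
    rewrite addr0; congr (_ * _); rewrite cardsD c cR natrB //.
    by rewrite -cR -c subset_leq_card // subsetIl.
  rewrite add0r; have [c|nc'] := eqVneq #|R :&: S| j.+1.
    congr (_%:R * _); rewrite -c; apply: eq_card => y; rewrite !inE.
    rewrite unfold_in; case yR: (y \in R); rewrite /= ?e // c; case: (y \in S); lia.
  rewrite eq_card0 ?mul0r // => y; rewrite unfold_in; case yR: (y \in R) => //.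
  by rewrite /= e //; apply/negP; case: (y \in S) => /eqP; lia.
have : \sum_(Q : {set T} | #|Q :&: S| == j) \sum_(y | y \notin Q) h (y |: Q) = 0.
  by rewrite big1.
rewrite (exchange_big_dep predT) //=.
under eq_bigr => y _ do
  (under eq_bigl => Q do rewrite andbC); under eq_bigr => y _ do
  rewrite (sum_setU1 y (fun Q => #|Q :&: S| == j)).
rewrite (exchange_big_dep predT) //=.
under eq_bigr => R _ do rewrite cnt.
by rewrite big_split /= -!big_mkcond /= -!mulr_sumr.
Qed.

(** The layer at i is [zeta h S] itself, and [layer_step] descends from there. This makes [zeta h]
    an eigenfunction of every operator given by intersection sizes. *)
Lemma layerE (T : finType) (i : nat) (h : {set T} -> rat) (S : {set T}) (l : nat) :
  harmonic i h -> (l <= i)%N ->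
  layer h (i - l) S = (-1) ^+ l * 'C(i, l)%:R * zeta h S.
Proof.
move=> hh; elim: l => [_|l IH li].
  rewrite subn0 bin0 expr0 !mul1r /layer /zeta big_mkcond [RHS]big_mkcond /=.
  apply: eq_bigr => R _; have [cR|/(proj1 hh) ->] := eqVneq #|R| i; last by rewrite !if_same.
  have -> : (R \subset S) = (R :&: S == R) by apply/setIidPl/eqP.
  by rewrite -cR eqEcard subsetIl /= eqn_leq subset_leq_card ?subsetIl.
have := layer_step (i - l.+1) S hh; rewrite -subSn // subSS IH 1?ltnW //.
rewrite natrB // => /eqP; rewrite addr_eq0 => /eqP e.
have l0 : l.+1%:R != 0 :> rat by rewrite pnatr_eq0.
apply: (mulfI l0); rewrite (_ : l.+1%:R * _ = (i%:R - (i%:R - l.+1%:R)) * layer h (i - l.+1) S); last by ring.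
rewrite e exprS.
have := mul_bin_left i l => /(congr1 (fun x => x%:R : rat)); rewrite !natrM => eb.
rewrite (_ : l.+1%:R * _ = - (-1) ^+ l * (l.+1%:R * 'C(i, l.+1)%:R) * zeta h S); last by ring.
rewrite eb; ring.
Qed.

(** * Decomposition into harmonic components *)

Lemma row_sqr_eq0 (n : nat) (w : 'rV[rat]_n) : w *m w^T = 0 -> w = 0.
Proof.
move=> /matrixP/(_ 0 0); rewrite !mxE => e; apply/rowP => j; rewrite mxE.
move: e => /eqP; rewrite psumr_eq0 => [|i _]; last by rewrite mxE -expr2 sqr_ge0.
by move=> /allP/(_ j (mem_index_enum _)); rewrite mxE mulf_eq0 orbb => /eqP.
Qed.

(** Least squares over the rationals: the row space of [b] meets the kernel of [b^T] trivially, so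
    [b *m b^T] has the rank of [b^T] and the system is solvable. *)
Lemma normal_equations (X Y : finType) (B : X -> Y -> rat) (f : Y -> rat) :
  exists g : X -> rat,
    forall x, \sum_y B x y * (f y - \sum_x' g x' * B x' y) = 0.
Proof.
pose b : 'M[rat]_(#|X|, #|Y|) := \matrix_(i, j) B (enum_val i) (enum_val j).
pose v : 'rV[rat]_#|Y| := \row_j f (enum_val j).
have ker0 : (b :&: kermx b^T)%MS = 0.
  apply/row_matrixP => i; rewrite row0; set w := row i _.
  have : (w <= b :&: kermx b^T)%MS by apply: row_sub.
  rewrite sub_capmx => /andP[/submxP[u wu] /sub_kermxP wk].
  by apply: row_sqr_eq0; rewrite [in w^T]wu trmx_mul mulmxA wk mul0mx.
have sub : (b^T <= b *m b^T)%MS.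
  rewrite -(mxrank_leqif_sup (submxMl b b^T)) mxrank_tr.
  by rewrite -[X in _ == X](mxrank_mul_ker b b^T) ker0 mxrank0 addn0.
have /submxP[D eD] : (v *m b^T <= b *m b^T)%MS by rewrite mulmx_sub.
exists (fun x => D 0 (enum_rank x)) => x.
move/rowP/(_ (enum_rank x)): eD; rewrite mulmxA !mxE => e.
rewrite (reindex_onto (@enum_val Y predT) (@enum_rank Y)) /=; last first.
  by move=> y _; rewrite enum_rankK.
under eq_bigl => j do rewrite enum_valK eqxx.
under eq_bigr => j _ do rewrite mulrBr.
have {}e : \sum_(j < #|Y|) B x (enum_val j) * f (enum_val j)
    = \sum_(j < #|Y|) B x (enum_val j) * (D *m b) 0 j.
  transitivity (\sum_j v 0 j * b^T j (enum_rank x)).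
    by apply: eq_bigr => j _; rewrite !mxE enum_rankK mulrC.
  by rewrite e; apply: eq_bigr => j _; rewrite [b^T _ _]mxE [b _ _]mxE enum_rankK mulrC.
rewrite big_split /= sumrN e; apply/eqP; rewrite subr_eq0; apply/eqP.
apply: eq_bigr => j _; rewrite !mxE; congr (_ * _).
rewrite [RHS](reindex_onto (@enum_val X predT) (@enum_rank X)) /=; last first.
  by move=> y _; rewrite enum_rankK.
under [RHS]eq_bigl => i do rewrite enum_valK eqxx.
by apply: eq_bigr => i _; rewrite !mxE enum_valK.
Qed.

Lemma zeta_top (T : finType) (i : nat) (h : {set T} -> rat) (S : {set T}) :
  harmonic i h -> #|S| = i -> zeta h S = h S.
Proof.
move=> [hs _] cS; rewrite /zeta (bigD1 S) //= big1 ?addr0 // => R /andP[RS RnS].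
apply: hs; rewrite -cS; apply: contra RnS => /eqP cR.
by rewrite eqEcard RS cR leqnn.
Qed.

(** Each i-subset of [S] survives the removal of [y] exactly when [y] is one of the [#|S| - i]
    elements outside it. *)
Lemma zeta_lower (T : finType) (i : nat) (h : {set T} -> rat) (S : {set T}) :
  harmonic i h -> (i <= #|S|)%N ->
  \sum_(y in S) zeta h (S :\ y) = (#|S| - i)%:R * zeta h S.
Proof.
move=> [hs _] iS; rewrite /zeta (exchange_big_dep (fun R : {set T} => R \subset S)) /=; last first.
  by move=> y R _ /subset_trans -> //; apply: subsetDl.
rewrite mulr_sumr; apply: eq_bigr => R RS.
have [cR|/hs ->] := eqVneq #|R| i; last by rewrite big1 // mulr0.
rewrite sumr_const_pred; congr (_%:R * _).
rewrite -cR -[in RHS](setIidPr RS) -cardsD; apply: eq_card => y.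
by rewrite unfold_in /= !inE subsetD1 RS /= andbC.
Qed.

Lemma harmonic_scale (T : finType) (i : nat) (h : {set T} -> rat) (a : rat) :
  harmonic i h -> harmonic i (fun R => a * h R).
Proof.
move=> [hs hh]; split=> [R /hs ->|Q]; first by rewrite mulr0.
by rewrite -mulr_sumr hh mulr0.
Qed.

(** Induction on r: project [f] orthogonally onto the functions lifted from r-sets. The residual is
    harmonic of degree r + 1, and the function [g] on r-sets is decomposed by induction. *)
Lemma harmonic_decomposition (T : finType) (r : nat) (f : {set T} -> rat) :
  exists h : nat -> {set T} -> rat, (forall i, harmonic i (h i)) /\
    forall S : {set T}, #|S| = r -> f S = \sum_(i < r.+1) zeta (h i) S.
Proof.
elim: r f => [|r IH] f.
  exists (fun i R => if (i == 0)%N && (R == set0) then f R else 0); split.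
    move=> i; split=> [R|Q].
      by case: (i =P 0%N) => [->|_] //=; case: (R =P set0) => [->|//]; rewrite cards0 eqxx.
    rewrite big1 // => y _; case: ifP => // /andP[_ /eqP/setP/(_ y)].
    by rewrite !inE eqxx.
  move=> S /eqP; rewrite cards_eq0 => /eqP ->.
  rewrite big_ord1 /zeta (bigD1 set0) //= eqxx big1 ?addr0 // => R.
  by rewrite subset0 => /andP[/eqP ->]; rewrite eqxx.
(* The inclusion matrix of r-sets in (r+1)-sets, extended by zero. *)
pose B (Q R : {set T}) : rat :=
  (#|Q| == r)%:R * \sum_(y | y \notin Q) (R == y |: Q)%:R.
pose f0 (S : {set T}) := if #|S| == r.+1 then f S else 0.
have [g gP] := normal_equations B f0.
pose h' (R : {set T}) := f0 R - \sum_Q g Q * B Q R.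
have hh' : harmonic r.+1 h'.
  split=> [R cR|Q].
    rewrite /h' /f0 (negPf cR) big1 ?subr0 // => Q _.
    rewrite /B; case: eqP => cQ; last by rewrite mul0r mulr0.
    rewrite big1 ?mulr0 // => y yQ; case: eqP => // eR.
    by move: cR; rewrite eR cardsU1 yQ cQ add1n eqxx.
  have [cQ|cQ] := eqVneq #|Q| r; last first.
    rewrite big1 // => y yQ; rewrite /h' /f0 cardsU1 yQ add1n eqSS (negPf cQ).
    rewrite big1 ?subr0 // => Q' _; rewrite /B; case: eqP => cQ'; last by rewrite mul0r mulr0.
    rewrite big1 ?mulr0 // => z zQ; case: eqP => // /(congr1 (fun A : {set T} => #|A|)).
    by rewrite !cardsU1 yQ zQ cQ' => /eqP; rewrite eqn_add2l (negPf cQ).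
  (* The normal equation at [Q] is the harmonic condition at [Q]. *)
  rewrite -[RHS](gP Q) {1}/B cQ eqxx.
  under [RHS]eq_bigr => R _ do rewrite mul1r -/(h' R) mulr_suml.
  rewrite exchange_big /=; apply: eq_bigr => y yQ.
  rewrite (bigD1 (y |: Q)) //= eqxx mul1r big1 ?addr0 // => R /negPf ->.
  by rewrite mul0r.
have [hl [hlh hlP]] := IH g.
(* Lifting by one level multiplies [zeta (hl i)] by [r.+1 - i], by [zeta_lower]. *)
exists (fun i => if (i == r.+1)%N then h' else fun R => (r.+1 - i)%:R * hl i R); split.
  by move=> i; case: eqP => [->|_] //; apply: harmonic_scale.
move=> S cS; rewrite big_ord_recr /= eqxx (zeta_top hh' cS) /h' /f0 cS eqxx.
rewrite addrCA -[LHS]addr0; congr (_ + _); apply/esym/eqP; rewrite subr_eq0; apply/eqP.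
transitivity (\sum_(y in S) g (S :\ y)).
  have cSy y : y \in S -> #|S :\ y| = r.
    by move=> yS; move: cS; rewrite (cardsD1 y) yS add1n => -[].
  rewrite (eq_bigr _ (fun y yS => hlP _ (cSy y yS))) [RHS]exchange_big /=.
  apply: eq_bigr => i _; rewrite ltn_eqF // (zeta_lower (hlh i)) ?cS 1?ltnW //.
  by rewrite /zeta mulr_sumr.
rewrite /B; under [RHS]eq_bigr => Q _ do rewrite !mulr_sumr big_mkcond.
rewrite exchange_big /= big_mkcond; apply: eq_bigr => y _.
rewrite -big_mkcond /=.
rewrite (eq_bigl (fun Q : {set T} => (y \notin Q) && predT Q)); last by move=> Q; rewrite andbT.
pose F (R : {set T}) : rat := g (R :\ y) * ((#|R :\ y| == r)%:R * (S == R)%:R).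
rewrite (eq_bigr (fun Q : {set T} => F (y |: Q))); last first.
  by move=> Q /andP[yQ _]; rewrite /F setU1K.
rewrite (sum_setU1 y predT F) /F /=; case yS: (y \in S); last first.
  rewrite big1 // => R /andP[yR _]; case: (S =P R) => [e|]; last by rewrite !mulr0.
  by rewrite -e yS in yR.
rewrite (bigD1 S) ?yS //= eqxx big1 ?addr0 => [|R /andP[_ /negPf]]; last first.
  by rewrite eq_sym => ->; rewrite !mulr0.
by move: cS; rewrite (cardsD1 y) yS add1n => -[->]; rewrite eqxx !mulr1.
Qed.

(** * Orthogonality of the harmonic components *)

Lemma sum_by_layer (T : finType) (h : {set T} -> rat) (S : {set T}) (phi : nat -> rat) :
  \sum_R h R * phi #|R :&: S| = \sum_(l < #|T|.+1) phi l * layer h l S.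
Proof.
rewrite (partition_big (fun R : {set T} => inord #|R :&: S| : 'I_#|T|.+1) predT) //=.
apply: eq_bigr => l _; rewrite /layer mulr_sumr.
have e (R : {set T}) : (inord #|R :&: S| == l) = (#|R :&: S| == l)%N.
  by rewrite -val_eqE /= inordK // ltnS max_card.
by apply: eq_big => [R|R]; rewrite e // => /eqP ->; rewrite mulrC.
Qed.

Lemma layer_small (T : finType) (i : nat) (h : {set T} -> rat) (R : {set T}) (l : nat) :
  harmonic i h -> (#|R| < i)%N -> layer h l R = 0.
Proof.
move=> hh Ri; have [li|il] := leqP l i; last first.
  rewrite /layer big1 // => R' /eqP c; apply: (proj1 hh); apply/eqP => cR'.
  by have := subset_leq_card (subsetIl R' R); lia.
rewrite -(subKn li) (layerE _ hh) ?leq_subr // /zeta big1 ?mulr0 // => R' /subset_leq_card c.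
by apply: (proj1 hh); apply/eqP; lia.
Qed.

Lemma card_above (T : finType) (R : {set T}) (k : nat) : (k <= #|T|)%N ->
  #|[set S : {set T} | (R \subset S) && (#|S| == k)]| = 'C(#|T| - #|R|, #|T| - k).
Proof.
move=> kT; rewrite -cardsT -card_between ?cardsT // ?subsetT //.
by apply: eq_card => S; rewrite !inE subsetT.
Qed.

Lemma sum_zeta_exchange (T : finType) (h : {set T} -> rat) (P : pred {set T}) :
  \sum_(S | P S) zeta h S = \sum_R h R * #|[set S : {set T} | (R \subset S) && P S]|%:R.
Proof.
rewrite /zeta (exchange_big_dep predT) //=; apply: eq_bigr => R _.
rewrite sumr_const_pred mulrC; congr (_ * _%:R); rewrite cardsE.
by apply: eq_card => S; rewrite unfold_in /= andbC.
Qed.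

(** The number of k-sets containing [R] and another set [R'] of size i depends only on
    [#|R' :&: R|], so the sum is a combination of layers at [R]. These vanish, since [R] has no
    i-subset. *)
Lemma sum_above (T : finType) (k i : nat) (h : {set T} -> rat) (R : {set T}) :
  harmonic i h -> (#|R| < i)%N -> (k <= #|T|)%N ->
  \sum_(S : {set T} | (R \subset S) && (#|S| == k)) zeta h S = 0.
Proof.
move=> hh Ri kT; rewrite sum_zeta_exchange.
pose phi l : rat := 'C(#|T| - (#|R| + i - l), #|T| - k)%:R.
rewrite (eq_bigr (fun R' => h R' * phi #|R' :&: R|)); last first.
  move=> R' _; have [c|/(proj1 hh) ->] := eqVneq #|R'| i; last by rewrite !mul0r.
  rewrite /phi -c addnC -cardsU -card_above //; congr (_ * (#|pred_of_set _|)%:R).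
  by apply/setP => S; rewrite !inE subUset andbA.
by rewrite sum_by_layer big1 // => l _; rewrite (layer_small _ hh) ?mulr0.
Qed.

(** Expand the factor of lower degree; [sum_above] kills the other factor above each set of that
    size. *)
Lemma zeta_orthogonal (T : finType) (k i j : nat) (h h' : {set T} -> rat) :
  harmonic i h -> harmonic j h' -> i != j -> (k <= #|T|)%N ->
  \sum_(S : {set T} | #|S| == k) zeta h S * zeta h' S = 0.
Proof.
wlog ij : i j h h' / (i < j)%N => [wl hh hh' nij kT|hh hh' _ kT].
  have [ij|ij] := ltnP i j; first exact: (wl i j).
  under eq_bigr do rewrite mulrC.
  by apply: (wl j i) => //; [rewrite ltn_neqAle eq_sym nij | rewrite eq_sym].
rewrite {1}/zeta; under eq_bigr do rewrite mulr_suml.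
rewrite (exchange_big_dep predT) //= big1 // => R _.
have [c|/(proj1 hh) ->] := eqVneq #|R| i; last by rewrite big1 // => S _; rewrite mul0r.
rewrite -mulr_sumr (eq_bigl (fun S : {set T} => (R \subset S) && (#|S| == k))); last first.
  by move=> S; rewrite andbC.
by rewrite (sum_above hh') ?mulr0 ?c.
Qed.

(** * Eigenvalues of the intersection operators *)

Lemma card_above_disjoint (T : finType) (R S : {set T}) (k : nat) : (k <= #|~: S|)%N ->
  #|[set X : {set T} | (R \subset X) && ((#|X| == k) && (#|X :&: S| == 0)%N)]|
  = if #|R :&: S| == 0%N then 'C(#|~: S| - #|R|, #|~: S| - k) else 0%N.
Proof.
move=> kS; have dj (X : {set T}) : (#|X :&: S| == 0)%N = (X \subset ~: S).
  by rewrite cards_eq0 setI_eq0 disjoints_subset.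
rewrite dj; case: ifP => RS.
  rewrite -card_between //; apply: eq_card => X; rewrite !inE dj.
  by congr (_ && _); rewrite andbC.
apply: eq_card0 => X; rewrite !inE dj; apply/negP => /and3P[RX _ XS].
by rewrite (subset_trans RX XS) in RS.
Qed.

Lemma card_above_point (T : finType) (R S : {set T}) (k : nat) (y : T) :
  (k <= #|~: S|.+1)%N -> y \in S ->
  #|[set X : {set T} | (R \subset X) && ((#|X| == k) && (X :&: S == [set y]))]|
  = if R :&: S \subset [set y]
    then 'C(#|~: S|.+1 - #|y |: R|, #|~: S|.+1 - k) else 0%N.
Proof.
move=> kS yS.
have cS : #|y |: ~: S| = #|~: S|.+1 by rewrite cardsU1 inE yS.
have e (X : {set T}) : (X :&: S == [set y]) = (y \in X) && (X \subset y |: ~: S).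
  apply/eqP/andP => [e|[yX XS]].
    split; first by have := set11 y; rewrite -e inE => /andP[].
    apply/subsetP => x xX; rewrite !inE; case: (boolP (x \in S)) => xS; last by rewrite orbT.
    by have : x \in [set y] by [rewrite -e inE xX]; rewrite inE => ->.
  apply/setP => x; rewrite !inE; apply/andP/eqP => [[xX xS]|->] //.
  by have := subsetP XS x xX; rewrite !inE xS orbF => /eqP.
case: ifP => RS.
  rewrite -cS -card_between ?cS //; last first.
    rewrite subUset sub1set !inE eqxx /=; apply/subsetP => x xR.
    rewrite !inE; case: (boolP (x \in S)) => xS; last by rewrite orbT.
    by rewrite -in_set1 (subsetP RS) // inE xR.
  apply: eq_card => X; rewrite !inE e subUset sub1set.
  by case: (y \in X); case: (R \subset X); case: (#|X| == k); rewrite /= ?andbT ?andbF.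
apply: eq_card0 => X; rewrite !inE; apply/negP => /and3P[RX _ /eqP XS].
by rewrite -XS setSI in RS.
Qed.

Lemma card_above_one (T : finType) (R S : {set T}) (k : nat) : (k <= #|~: S|.+1)%N ->
  #|[set X : {set T} | (R \subset X) && ((#|X| == k) && (#|X :&: S| == 1)%N)]|
  = if #|R :&: S| == 0%N then (#|S| * 'C(#|~: S| - #|R|, #|~: S|.+1 - k))%N
    else if #|R :&: S| == 1%N then 'C(#|~: S|.+1 - #|R|, #|~: S|.+1 - k) else 0%N.
Proof.
move=> kS.
transitivity (\sum_(y in S)
  #|[set X : {set T} | (R \subset X) && ((#|X| == k) && (X :&: S == [set y]))]|)%N.
  rewrite -sum1_card; under [RHS]eq_bigr do rewrite -sum1_card.
  rewrite (exchange_big_dep [pred X : {set T} | (R \subset X) && ((#|X| == k) && (#|X :&: S| == 1)%N)]) /=; last first.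
    by move=> y X yS; rewrite !inE => /and3P[-> -> /eqP ->]; rewrite cards1.
  apply: eq_big => X; first by rewrite inE.
  rewrite inE => /and3P[RX cX /cards1P[y e]].
  rewrite (bigD1 y) /=; last first.
    by rewrite !inE RX cX e eqxx; have := set11 y; rewrite -e inE => /andP[_ ->].
  rewrite big1 // => z /andP[/andP[_]]; rewrite !inE RX cX e /= => /eqP/setP/(_ z).
  by rewrite !inE eqxx => /eqP ->; rewrite eqxx.
rewrite (eq_bigr _ (fun y yS => card_above_point R kS yS)).
case: ifP => [|c0].
  rewrite cards_eq0 => /eqP RS0; rewrite -sum_nat_const; apply: eq_bigr => y yS.
  rewrite RS0 sub0set cardsU1; case: (boolP (y \in R)) => yR; last by rewrite add1n subSS.
  by have := in_set0 y; rewrite -RS0 inE yR yS.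
case: ifP => [/cards1P[x e]|c1].
  have /setIP[xR xS] : x \in R :&: S by rewrite e inE.
  rewrite (bigD1 x) //= e subxx big1 ?addn0; last first.
    by move=> y /andP[_ yx]; rewrite sub1set inE eq_sym (negPf yx).
  by rewrite (setUidPr _) // sub1set.
rewrite big1 // => y yS; case: ifP => // /subset_leq_card; rewrite cards1; lia.
Qed.

Definition nbr_sum (T : finType) (k j : nat) (f : {set T} -> rat) (S : {set T}) : rat :=
  \sum_(X : {set T} | (#|X| == k) && (#|X :&: S| == j)) f X.

Lemma nbr_sum0 (T : finType) (k i : nat) (h : {set T} -> rat) (S : {set T}) :
  harmonic i h -> (k <= #|~: S|)%N ->
  nbr_sum k 0 (zeta h) S = (-1) ^+ i * 'C(#|~: S| - i, #|~: S| - k)%:R * zeta h S.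
Proof.
move=> hh kS; rewrite /nbr_sum sum_zeta_exchange.
have := layerE S hh (leqnn i); rewrite subnn binn mulr1 => e.
rewrite mulrAC -e mulrC /layer mulr_sumr [RHS]big_mkcond; apply: eq_bigr => R _ /=.
have [c|/(proj1 hh) ->] := eqVneq #|R| i; last by rewrite mul0r mulr0 if_same.
by rewrite card_above_disjoint // c mulrC; case: ifP; rewrite ?mul0r.
Qed.

(** Only layers 0 and 1 at [S] contribute. Layer 1 is -i times layer 0, and layer 0 is [zeta h S] up
    to sign. *)
Lemma nbr_sum1 (T : finType) (k i : nat) (h : {set T} -> rat) (S : {set T}) :
  harmonic i h -> (k <= #|~: S|.+1)%N ->
  nbr_sum k 1 (zeta h) S =
    (-1) ^+ i * (#|S|%:R * 'C(#|~: S| - i, #|~: S|.+1 - k)%:R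
                 - i%:R * 'C(#|~: S|.+1 - i, #|~: S|.+1 - k)%:R) * zeta h S.
Proof.
move=> hh kS; rewrite /nbr_sum sum_zeta_exchange.
have := layerE S hh (leqnn i); rewrite subnn binn mulr1 => e.
have := layer_step 0 S hh; rewrite subr0 mul1r addrC => /eqP; rewrite addr_eq0 => /eqP e1.
transitivity (#|S|%:R * 'C(#|~: S| - i, #|~: S|.+1 - k)%:R * layer h 0 S +
   'C(#|~: S|.+1 - i, #|~: S|.+1 - k)%:R * layer h 1 S); last by rewrite e1 e; ring.
rewrite /layer !mulr_sumr [X in _ = X + _]big_mkcond [X in _ = _ + X]big_mkcond -big_split /=.
apply: eq_bigr => R _.
have [c|/(proj1 hh) ->] := eqVneq #|R| i; last by rewrite mul0r !mulr0 !if_same addr0.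
rewrite card_above_one // c mulrC; case: ifP => [/eqP ->|_] /=; first by rewrite natrM addr0.
by case: ifP => _; rewrite ?mul0r ?add0r.
Qed.

Lemma sum_slice (T : finType) (k i : nat) (h : {set T} -> rat) (S : {set T}) :
  harmonic i h -> (k <= #|T|)%N ->
  \sum_(X : {set T} | #|X| == k) zeta h X = (i == 0)%N%:R * 'C(#|T|, k)%:R * zeta h S.
Proof.
move=> hh kT; case: i => [|i] in hh *.
  have z (X : {set T}) : zeta h X = h set0.
    rewrite /zeta (bigD1 set0) ?sub0set //= big1 ?addr0 // => R /andP[_ R0].
    by apply: (proj1 hh); rewrite cards_eq0.
  rewrite mul1r -card_draws z (eq_bigr (fun=> h set0)) => [|X _]; last exact: z.
  by rewrite sumr_const_pred cardsE.
rewrite mul0r mul0r -[RHS](sum_above (R := set0) hh _ kT) ?cards0 //.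
by apply: eq_bigl => X; rewrite sub0set.
Qed.

(** * A weighted Hoffman bound *)

(** With n = 2k + e this is e + 1 times C(n-k-1, k-2), the count obtained in [tight_coclique]. *)
Definition theta (e k : nat) : rat := e.+1%:R * 'C(k + e - 1, k - 2)%:R.

(* The eigenvalues on the first three eigenspaces vanish for this choice. *)
Definition weight0 (e k : nat) : rat := (k%:R - 1) * (k%:R - 2) - e.+1%:R.

(** The last coefficient makes the first and last terms of the quadratic form cancel on families of
    size C(n-2, k-2). *)
Definition hoffman_op (T : finType) (e k : nat) (f : {set T} -> rat) (S : {set T}) : rat :=
  theta e k * f S + e.+1%:R * nbr_sum k 1 f S - weight0 e k * nbr_sum k 0 f S
  - theta e k / 'C(#|T| - 2, k - 2)%:R * \sum_(X : {set T} | #|X| == k) f X.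

(* The eigenvalue on the i-th harmonic space; 'C(e + (k - i), e) is the number
   of k-sets containing a given i-set and disjoint from a given k-set disjoint
   from it, and the last factor collects the contributions of A_0 and A_1. *)
Definition eigenval (e k i : nat) : rat :=
  theta e k + (-1) ^+ i * 'C(e + (k - i), e)%:R
    * (((k - i) ^ 2)%:R - (i%:R - 1) * e.+1%:R - (k%:R - 1) * (k%:R - 2))
  - (i == 0)%N%:R * (theta e k / 'C(2 * k + e - 2, k - 2)%:R * 'C(2 * k + e, k)%:R).

Lemma bin_shift (e j : nat) :
  (j%:R + 1) * 'C(e + j.+1, e)%:R = (e%:R + j%:R + 1) * 'C(e + j, e)%:R :> rat.
Proof.
have := mul_bin_down (e + j.+1) e; rewrite addKn addnS /= => /(congr1 (fun x => x%:R : rat)).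
by rewrite !natrM -!natr1 natrD => <-.
Qed.

Lemma eigenvalE (T : finType) (e k i : nat) (h : {set T} -> rat) (S : {set T}) :
  #|T| = (2 * k + e)%N -> (i <= k)%N -> #|S| = k -> harmonic i h ->
  hoffman_op e k (zeta h) S = eigenval e k i * zeta h S.
Proof.
move=> cT ik cS hh.
have cC : #|~: S| = (k + e)%N by rewrite cardsCs setCK cT cS; lia.
rewrite /hoffman_op (nbr_sum1 hh) ?(nbr_sum0 hh) ?(sum_slice S hh) ?cC; try lia.
rewrite /eigenval cT cS.
have [j kE] : exists j, k = (i + j)%N by exists (k - i)%N; lia.
have -> : (k - i = j)%N by lia.
have -> : (k + e - i = e + j)%N by lia.
have -> : (k + e - k = e)%N by lia.
have -> : ((k + e).+1 - k = e.+1)%N by lia.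
have -> : ((k + e).+1 - i = (e + j).+1)%N by lia.
(* Absorption turns both binomials of the A_1 term into multiples of C(e + j, e). *)
have e1 : e.+1%:R * 'C(e + j, e.+1)%:R = j%:R * 'C(e + j, e)%:R :> rat.
  by rewrite -!natrM mul_bin_left addKn.
have e2 : e.+1%:R * 'C((e + j).+1, e.+1)%:R = (e%:R + j%:R + 1) * 'C(e + j, e)%:R :> rat.
  by rewrite -natrM -mul_bin_diag natrM -natr1 natrD.
set a := 'C(e + j, e.+1)%:R in e1 *; set b := 'C((e + j).+1, e.+1)%:R in e2 *.
set D := 'C(e + j, e)%:R in e1 e2 *.
set c := theta e k / _ ; set t := theta e k; set z := zeta h S; set N := 'C(_, k)%:R.
rewrite (_ : e.+1%:R * _ = (-1) ^+ i * (k%:R * (e.+1%:R * a) - i%:R * (e.+1%:R * b)) * z); last by ring.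
rewrite e1 e2 /weight0 kE natrX !natrD -!natr1; ring.
Qed.

Lemma thetaE (e k : nat) : (2 <= k)%N ->
  theta e k = (k%:R - 1) * 'C(e + (k - 1), e)%:R.
Proof.
move=> k2; rewrite /theta.
have -> : 'C(k + e - 1, k - 2) = 'C(e + (k - 1), e.+1).
  by rewrite -[RHS]bin_sub; [congr 'C(_, _) | ]; lia.
rewrite -natrM mul_bin_left addKn natrM natrB //; lia.
Qed.

Lemma eigenval0 (e k : nat) : (3 <= k)%N -> eigenval e k 0 = 0.
Proof.
move=> k3; rewrite /eigenval thetaE ?(ltnW k3) // expr0 eqxx mul1r subn0.
have [j kE] : exists j, k = (j + 2)%N by exists (k - 2)%N; lia.
subst k; have -> : (j + 2 - 1 = j.+1)%N by lia.
have -> : (j + 2 - 2 = j)%N by lia.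
have -> : (j + 2 = j.+2)%N by lia.
have -> : (2 * j.+2 + e - 2 = e + 2 * j + 2)%N by lia.
have -> : (2 * j.+2 + e = (e + 2 * j + 2).+2)%N by lia.
have := bin_shift e j.+1.
set D := 'C(e + j.+1, e)%:R; set D' := 'C(e + j.+2, e)%:R => eD.
(* Two absorptions reduce C(n, k) to C(n-2, k-2), where n = 2k + e. *)
have n1 := mul_bin_diag (e + 2 * j + 2).+1 j.
have n2 := mul_bin_diag (e + 2 * j + 2).+2 j.+1.
move: n1 n2 => /= /(congr1 (fun x => x%:R : rat)) n1 /(congr1 (fun x => x%:R : rat)) n2.
move: n1 n2; rewrite !natrM.
have : 'C(e + 2 * j + 2, j)%:R != 0 :> rat by rewrite pnatr_eq0 -lt0n bin_gt0; lia.
set A := 'C(_, j)%:R; set A1 := 'C(_, j.+1)%:R; set A2 := 'C(_, j.+2)%:R => A0 n1 n2.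
have j1 : (j%:R + 1 : rat) != 0 by rewrite natr1 pnatr_eq0.
have j2 : (j%:R + 1 + 1 : rat) != 0 by rewrite !natr1 pnatr_eq0.
rewrite -!natr1 ?natrD ?natrM -?natr1 in eD n1 n2 *.
have eA1 : A1 = (e%:R + 2 * j%:R + 2 + 1) * A / (j%:R + 1).
  by apply: (canRL (mulfK j1)); rewrite mulrC -n1; ring.
have eA2 : A2 = (e%:R + 2 * j%:R + 2 + 1 + 1) * A1 / (j%:R + 1 + 1).
  by apply: (canRL (mulfK j2)); rewrite mulrC -n2; ring.
have eD' : D' = (e%:R + (j%:R + 1) + 1) * D / (j%:R + 1 + 1).
  by apply: (canRL (mulfK j2)); rewrite mulrC eD; ring.
rewrite eA2 eA1 eD'; field.
by rewrite A0 j1 j2.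
Qed.

Lemma eigenval1 (e k : nat) : (3 <= k)%N -> eigenval e k 1 = 0.
Proof.
move=> k3; rewrite /eigenval thetaE ?(ltnW k3) // expr1 [X in _ - X]mul0r natrX natrB //; last by lia.
by ring.
Qed.

Lemma eigenval2 (e k : nat) : (3 <= k)%N -> eigenval e k 2 = 0.
Proof.
move=> k3; rewrite /eigenval thetaE ?(ltnW k3) // [X in _ - X]mul0r natrX.
have [j ->] : exists j, k = (j + 2)%N by exists (k - 2)%N; lia.
have -> : (j + 2 - 1 = j.+1)%N by lia.
have -> : (j + 2 - 2 = j)%N by lia.
have -> : ((j + 2)%:R - 1 = j%:R + 1 :> rat) by rewrite natrD; ring.
rewrite bin_shift natrD -natr1; ring.
Qed.

(** From i = 3 on the eigenvalue is [theta] minus a term [E i] of sign (-1)^i, so odd i are clear.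
    For even i it suffices that [E 4] is at most [theta] and that [E] does not increase: from one
    index to the next its factor [A] at most doubles while the binomial at least halves. *)
Lemma eigenval_ge0 (e k i : nat) : (3 <= k)%N -> (k <= e + 3)%N -> (i <= k)%N ->
  0 <= eigenval e k i.
Proof.
move=> k3 ke ik.
case: i ik => [|[|[|i]]] ik; rewrite ?eigenval0 ?eigenval1 ?eigenval2 //.
pose A i : rat := (i%:R - 1) * e.+1%:R + (k%:R - 1) * (k%:R - 2) - ((k - i) ^ 2)%:R.
pose E i : rat := 'C(e + (k - i), e)%:R * A i.
have lamE : eigenval e k i.+3 = theta e k - (-1) ^+ i.+3 * E i.+3.
  by rewrite /eigenval /E /A [X in _ - X]mul0r; ring.
have A0 i' : (2 <= i' <= k)%N -> 0 <= A i'.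
  case/andP=> i2 i'k; rewrite /A natrX natrB // -natr1.
  have : (0 : rat) <= e%:R by []. 
  have : (2 : rat) <= i'%:R by rewrite ler_nat.
  have : (i'%:R : rat) <= k%:R by rewrite ler_nat.
  nra.
have th0 : 0 <= theta e k by rewrite mulr_ge0.
have E0 : 0 <= E i.+3 by rewrite mulr_ge0 // A0 // ik andbT.
rewrite lamE subr_ge0 -signr_odd /=.
case: (boolP (odd i)) => oi /=; last by rewrite expr1 mulN1r (le_trans _ th0) // oppr_le0.
rewrite expr0 mul1r.
(* Parity is forgotten here: [E] is bounded at every index from 4 on, so the induction moves by
   single steps. *)
case: i oi ik {lamE E0} => [//|i] _ ik.
have base : (4 <= k)%N -> E 4 <= theta e k.
  move=> k4; have [j kE] : exists j, k = (j + 4)%N by exists (k - 4)%N; lia.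
  rewrite thetaE ?(ltnW k3) // /E /A.
  have := bin_shift e j; have := bin_shift e j.+1; have := bin_shift e j.+2.
  rewrite kE; have -> : (j + 4 - 4 = j)%N by lia.
  have -> : (j + 4 - 1 = j.+3)%N by lia.
  set D0 := 'C(e + j, e)%:R; set D1 := 'C(e + j.+1, e)%:R; set D2 := 'C(e + j.+2, e)%:R.
  set D3 := 'C(_, e)%:R => d3 d2 d1.
  have D0_ge0 : 0 <= D0 by [].
  (* With the slack [t] in k <= e + 3, the difference, cleared of denominators, is [D0] times a
     polynomial with nonnegative coefficients. *)
  have [t eE] : exists t, (e = j + 1 + t)%N by exists (e - (j + 1))%N; lia.
  have ej : e%:R = j%:R + 1 + t%:R :> rat by rewrite eE !natrD.
  have -> : ((j + 4)%:R - 1) * D3 = (e%:R + j.+2%:R + 1) * D2.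
    by rewrite -d3 natrD -!natr1; ring.
  have x1 : j.+2%:R * (j.+1%:R * ((e%:R + j.+2%:R + 1) * D2))
    = (e%:R + j.+2%:R + 1) * (e%:R + j%:R + 2) * (e%:R + j%:R + 1) * D0.
    have -> : j.+2%:R * (j.+1%:R * ((e%:R + j.+2%:R + 1) * D2))
      = (e%:R + j.+2%:R + 1) * j.+1%:R * ((j.+1%:R + 1) * D2) by rewrite -!natr1; ring.
    rewrite d2.
    have -> : (e%:R + j.+2%:R + 1) * j.+1%:R * ((e%:R + j.+1%:R + 1) * D1)
      = (e%:R + j.+2%:R + 1) * (e%:R + j.+1%:R + 1) * ((j%:R + 1) * D1) by rewrite -!natr1; ring.
    by rewrite d1 -!natr1; ring.
  rewrite -(ler_pM2l (_ : 0 < j.+1%:R :> rat)) // -(ler_pM2l (_ : 0 < j.+2%:R :> rat)) // x1.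
  rewrite -subr_ge0 -!natr1 ej natrX natrD.
  rewrite (_ : _ - _ = D0 * ((j%:R + 2) * (j%:R + 1) * t%:R
     + (2 * (2 * j%:R + 3) * t%:R + t%:R ^+ 2) * (2 * j%:R + 3 + t%:R))); last by ring.
  by rewrite mulr_ge0 // addr_ge0 // ?mulr_ge0 // ?addr_ge0 // ?mulr_ge0 // ?exprn_ge0 ?addr_ge0 ?mulr_ge0.
elim: i ik => [|i IH] ik; first exact: base.
apply: le_trans (IH (ltnW ik)).
have [j kE] : exists j, k = (i.+4 + j.+1)%N by exists (k - i.+4.+1)%N; lia.
have Ai : 0 <= A i.+4 by apply: A0; lia.
have eA : A i.+4.+1 <= 2 * A i.+4.
  rewrite /A; have -> : (k - i.+4.+1 = j)%N by lia.
  have -> : (k - i.+4 = j.+1)%N by lia.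
  rewrite kE !natrX natrD -!natr1.
  have : (0 : rat) <= e%:R by []. have : (0 : rat) <= i%:R by []. have : (0 : rat) <= j%:R by [].
  nra.
rewrite /E; have -> : (k - i.+4.+1 = j)%N by lia.
have -> : (k - i.+4 = j.+1)%N by lia.
have Dd : 2 * 'C(e + j, e)%:R <= 'C(e + j.+1, e)%:R :> rat.
  have := bin_shift e j; have j1 : 0 < j%:R + 1 :> rat by rewrite natr1.
  move=> eD; rewrite -(ler_pM2l j1) eD.
  have je : j%:R + 1 <= e%:R :> rat by rewrite natr1 ler_nat; lia.
  rewrite mulrA ler_wpM2r //; lra.
apply: le_trans (_ : 'C(e + j, e)%:R * (2 * A i.+4) <= _); first by rewrite ler_wpM2l.
by rewrite mulrA ler_wpM2r // mulrC.
Qed.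

Lemma hoffman_op_sum (T : finType) (e k : nat) (N : nat) (f : 'I_N -> {set T} -> rat) (S : {set T}) :
  hoffman_op e k (fun X => \sum_i f i X) S = \sum_i hoffman_op e k (f i) S.
Proof.
rewrite /hoffman_op !sumrB big_split /= -!mulr_sumr /nbr_sum.
by congr (_ + _ * _ - _ * _ - _ * _); rewrite exchange_big.
Qed.

(** By orthogonality the form is a sum of eigenvalues times squared norms. If it vanishes, each
    component is zero or has eigenvalue zero, so the operator kills [f]. *)
Lemma hoffman_psd (T : finType) (e k : nat) (f : {set T} -> rat) :
  #|T| = (2 * k + e)%N -> (3 <= k)%N -> (k <= e + 3)%N ->
  0 <= \sum_(S : {set T} | #|S| == k) f S * hoffman_op e k f S /\
  (\sum_(S : {set T} | #|S| == k) f S * hoffman_op e k f S = 0 ->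
   forall S : {set T}, #|S| = k -> hoffman_op e k f S = 0).
Proof.
move=> cT k3 ke; have [h [hh fE]] := harmonic_decomposition k f.
have opE (S : {set T}) : #|S| = k ->
    hoffman_op e k f S = \sum_(i < k.+1) eigenval e k i * zeta (h i) S.
  move=> cS; transitivity (hoffman_op e k (fun X => \sum_(i < k.+1) zeta (h i) X) S).
    rewrite /hoffman_op /nbr_sum fE //; congr (_ + _ * _ - _ * _ - _ * _); apply: eq_bigr => X.
    - by case/andP => /eqP /fE.
    - by case/andP => /eqP /fE.
    - by move/eqP/fE.
  rewrite (hoffman_op_sum e k (fun i : 'I_k.+1 => zeta (h i))); apply: eq_bigr => i _.
  by rewrite (eigenvalE cT _ cS (hh i)) // -ltnS.
pose nrm i := \sum_(S : {set T} | #|S| == k) zeta (h i) S ^+ 2.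
have nrm0 i : 0 <= nrm i by apply: sumr_ge0 => S _; apply: sqr_ge0.
have QE : \sum_(S : {set T} | #|S| == k) f S * hoffman_op e k f S
    = \sum_(i < k.+1) eigenval e k i * nrm i.
  transitivity (\sum_(S : {set T} | #|S| == k) \sum_(j < k.+1) \sum_(i < k.+1)
      eigenval e k i * (zeta (h j) S * zeta (h i) S)).
    apply: eq_bigr => S /eqP cS; rewrite opE // fE // mulr_suml; apply: eq_bigr => j _.
    by rewrite mulr_sumr; apply: eq_bigr => i _; rewrite mulrCA.
  under eq_bigr do rewrite exchange_big /=.
  rewrite exchange_big /=; apply: eq_bigr => i _; rewrite exchange_big /=.
  rewrite (bigD1 i) //= [X in _ + X]big1 ?addr0 => [|j ji].
    by rewrite -mulr_sumr; congr (_ * _); apply: eq_bigr => S _; rewrite expr2.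
  rewrite -mulr_sumr (zeta_orthogonal (hh j) (hh i)) ?mulr0 //; first by rewrite cT; lia.
have lam0 (i : 'I_k.+1) : 0 <= eigenval e k i by rewrite eigenval_ge0 // -ltnS.
rewrite QE; split=> [|/eqP]; first by apply: sumr_ge0 => i _; rewrite mulr_ge0.
rewrite psumr_eq0 => [/allP q0 S cS|i _]; last by rewrite mulr_ge0.
rewrite opE // big1 // => i _.
have /= := q0 i (mem_index_enum _); rewrite mulf_eq0 => /orP[/eqP ->|]; first by rewrite mul0r.
rewrite /nrm psumr_eq0 => [/allP z0|X _]; last exact: sqr_ge0.
have := z0 S (mem_index_enum _); rewrite cS eqxx /= expf_eq0 /= => /eqP ->.
by rewrite mulr0.
Qed.

(** * The coclique bound and its equality case *)

Lemma nbr_sum_indicator (T : finType) (k j : nat) (F : {set {set T}}) (S : {set T}) :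
  uniform k F ->
  nbr_sum k j (fun X => (X \in F)%:R) S = #|[set X in F | #|X :&: S| == j]|%:R.
Proof.
move=> uF; rewrite /nbr_sum -sum1_card natr_sum big_mkcond [RHS]big_mkcond /=.
apply: eq_bigr => X _; rewrite !inE; case: (boolP (X \in F)) => XF /=; last by rewrite if_same.
by rewrite uF // eqxx.
Qed.

Lemma sum_indicator (T : finType) (k : nat) (F : {set {set T}}) (g : {set T} -> rat) :
  uniform k F ->
  \sum_(S : {set T} | #|S| == k) (S \in F)%:R * g S = \sum_(S in F) g S.
Proof.
move=> uF; rewrite big_mkcond [RHS]big_mkcond /=; apply: eq_bigr => S _.
case: (boolP (S \in F)) => SF; last by rewrite mul0r if_same.
by rewrite uF // eqxx mul1r.
Qed.

Lemma hoffman_op_indicator (T : finType) (e k : nat) (F : {set {set T}}) (S : {set T}) :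
  uniform k F ->
  hoffman_op e k (fun X => (X \in F)%:R) S =
    theta e k * (S \in F)%:R + e.+1%:R * #|[set X in F | #|X :&: S| == 1%N]|%:R
    - weight0 e k * #|[set X in F | #|X :&: S| == 0%N]|%:R
    - theta e k / 'C(#|T| - 2, k - 2)%:R * #|F|%:R.
Proof.
move=> uF; rewrite /hoffman_op !(nbr_sum_indicator _ _ uF).
congr (_ - _ * _); transitivity (\sum_(X in F) (1 : rat)); last by rewrite sumr_const.
by rewrite -(sum_indicator (fun=> 1) uF); apply: eq_bigr => X _; rewrite mulr1.
Qed.

Lemma quadratic_indicator (T : finType) (e k : nat) (F : {set {set T}}) :
  uniform k F -> {in F &, forall A B : {set T}, #|A :&: B| != 1%N} ->
  \sum_(S : {set T} | #|S| == k) (S \in F)%:R * hoffman_op e k (fun X => (X \in F)%:R) S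
  = #|F|%:R * (theta e k - theta e k / 'C(#|T| - 2, k - 2)%:R * #|F|%:R)
    - weight0 e k * \sum_(S in F) #|[set X in F | #|X :&: S| == 0%N]|%:R.
Proof.
move=> uF F1; rewrite (sum_indicator _ uF).
rewrite mulr_sumr -sumr_const_pred -sumrB; apply: eq_bigr => S SF.
rewrite (hoffman_op_indicator e S uF) SF mulr1.
have -> : [set X in F | #|X :&: S| == 1%N] = set0.
  by apply/setP => X; rewrite !inE; apply/negP => /andP[XF]; apply/negP; apply: F1.
by rewrite cards0 mulr0 addr0 addrAC.
Qed.

Lemma theta_gt0 (e k : nat) : 0 < theta e k.
Proof. by rewrite mulr_gt0 // ltr0n bin_gt0; lia. Qed.

Lemma weight0_gt0 (e k : nat) : (e.+1 < (k - 1) * (k - 2))%N -> 0 < weight0 e k.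
Proof.
move=> ek; have k2 : (2 <= k)%N by move: ek; case: k => [|[|k]].
have -> : weight0 e k = ((k - 1) * (k - 2))%:R - e.+1%:R.
  by rewrite natrM !natrB // ltnW.
by rewrite subr_gt0 ltr_nat.
Qed.

(** Disjoint pairs enter the form with the negative factor [- weight0], so the remaining term |F|
    (theta - theta |F| / C(n-2, k-2)) must be nonnegative. *)
Lemma coclique_bound (T : finType) (e k : nat) (F : {set {set T}}) :
  #|T| = (2 * k + e)%N -> (3 <= k)%N -> (k <= e + 3)%N -> (e.+1 < (k - 1) * (k - 2))%N ->
  uniform k F -> {in F &, forall A B : {set T}, #|A :&: B| != 1%N} ->
  (#|F| <= 'C(#|T| - 2, k - 2))%N.
Proof.
move=> cT k3 ke ek uF F1.
have [] := hoffman_psd (fun X => (X \in F)%:R) cT k3 ke.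
rewrite quadratic_indicator // => q0 _.
have th0 := theta_gt0 e k.
have w0 := weight0_gt0 ek.
have s0 : 0 <= \sum_(S in F) #|[set X in F | #|X :&: S| == 0%N]|%:R :> rat by apply: sumr_ge0.
have C0 : 0 < 'C(#|T| - 2, k - 2)%:R :> rat by rewrite ltr0n bin_gt0 cT; lia.
have [->//|Fn0] := posnP #|F|.
have F0 : 0 < #|F|%:R :> rat by rewrite ltr0n.
have : 0 <= #|F|%:R * (theta e k - theta e k / 'C(#|T| - 2, k - 2)%:R * #|F|%:R).
  by apply: le_trans q0 _; rewrite gerBl mulr_ge0 // ltW.
rewrite pmulr_rge0 // subr_ge0 -mulrA -[leRHS]mulr1 ler_pM2l // mulrC ler_pdivrMr // mul1r.
by rewrite ler_nat.
Qed.

(** At equality the form is [- weight0] times the number of disjoint pairs, so semidefiniteness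
    makes both zero. The kernel equation at [S] then equates e + 1 times the count with [theta]. *)
Lemma tight_coclique (T : finType) (e k : nat) (F : {set {set T}}) :
  #|T| = (2 * k + e)%N -> (3 <= k)%N -> (k <= e + 3)%N -> (e.+1 < (k - 1) * (k - 2))%N ->
  uniform k F -> {in F &, forall A B : {set T}, #|A :&: B| != 1%N} ->
  #|F| = 'C(#|T| - 2, k - 2) ->
  two_intersecting F /\
  forall S : {set T}, #|S| = k -> S \notin F -> {in F, forall X : {set T}, 0 < #|X :&: S|}%N ->
    #|[set X in F | #|X :&: S| == 1%N]| = 'C(k + e - 1, k - 2).
Proof.
move=> cT k3 ke ek uF F1 cF.
have [] := hoffman_psd (fun X => (X \in F)%:R) cT k3 ke.
rewrite quadratic_indicator // => q0 qker.
have th0 := theta_gt0 e k.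
have w0 := weight0_gt0 ek.
have s0 : 0 <= \sum_(S in F) #|[set X in F | #|X :&: S| == 0%N]|%:R :> rat by apply: sumr_ge0.
have C0 : 'C(#|T| - 2, k - 2)%:R != 0 :> rat by rewrite pnatr_eq0 -lt0n bin_gt0 cT; lia.
have q1 : theta e k - theta e k / 'C(#|T| - 2, k - 2)%:R * #|F|%:R = 0.
  by rewrite cF divfK // subrr.
rewrite q1 mulr0 sub0r in q0 qker.
have z : \sum_(S in F) #|[set X in F | #|X :&: S| == 0%N]|%:R = 0 :> rat.
  apply/eqP; rewrite eq_le s0 andbT -(pmulr_rle0 _ w0).
  by rewrite -oppr_ge0.
split.
  move=> A B AF BF; have := F1 A B AF BF.
  suff : #|A :&: B| != 0%N by lia.
  move/eqP: z; rewrite psumr_eq0 // => /allP/(_ B (mem_index_enum _)).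
  rewrite BF /= pnatr_eq0 => /eqP/cards0_eq e0.
  by have := in_set0 A; rewrite -e0 !inE AF /= => ->.
move=> S cS SF Spos.
have := qker _ S cS; rewrite z mulr0 oppr0 => /(_ erefl).
rewrite hoffman_op_indicator // (negPf SF) mulr0 add0r.
have -> : [set X in F | #|X :&: S| == 0%N] = set0.
  apply/setP => X; rewrite !inE; apply/negP => /andP[XF].
  by rewrite eqn0Ngt Spos.
rewrite cards0 mulr0 subr0 => /eqP; rewrite subr_eq0.
move/eqP: q1; rewrite subr_eq0 => /eqP <-; rewrite /theta => /eqP e1.
have e0 : e.+1%:R != 0 :> rat by rewrite pnatr_eq0.
by move/(mulfI e0)/eqP: e1; rewrite eqr_nat => /eqP.
Qed.

Local Close Scope ring_scope.

(** * Compressed families *)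

Definition swap (T : finType) (A : {set T}) (a x : T) : {set T} := x |: (A :\ a).

Lemma card_swapI (T : finType) (A B : {set T}) (a x : T) : a \in A -> x \notin A ->
  #|swap A a x :&: B| + (a \in B) = #|A :&: B| + (x \in B).
Proof.
move=> aA xA; have xa : x != a by apply: contraNneq xA => ->.
rewrite (cardsD1 a (A :&: B)) (cardsD1 x (swap A a x :&: B)) !inE eqxx aA /=.
suff -> : (swap A a x :&: B) :\ x = (A :&: B) :\ a by lia.
apply/setP => y; rewrite !inE; have [->|yx] := eqVneq y x; first by rewrite (negPf xA) andbF.
by rewrite /= andbA.
Qed.

Lemma card_swap (T : finType) (A : {set T}) (a x : T) : a \in A -> x \notin A ->
  #|swap A a x| = #|A|.
Proof.
by move=> aA xA; have := card_swapI setT aA xA; rewrite !setIT !inE => /addIn.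
Qed.

Lemma swapK (T : finType) (A : {set T}) (a x : T) : a \in A -> x \notin A ->
  swap (swap A a x) x a = A.
Proof.
move=> aA xA; apply/setP => y; rewrite !inE.
have [->|ya] := eqVneq y a; first by rewrite aA.
by have [->|yx] //= := eqVneq y x; rewrite (negPf xA).
Qed.

(** Trade an element of [A] outside [B] for one of [B] outside [A]; both lie in [D], and [A :\: B]
    shrinks. *)
Lemma swap_connected (T : finType) (P : {set T} -> Prop) (D : {set T}) :
  (forall (A : {set T}) (a x : T), P A -> a \in A -> x \notin A -> a \in D -> x \in D ->
     P (swap A a x)) ->
  forall A B : {set T}, P A -> A :\: D = B :\: D -> #|A| = #|B| -> P B.
Proof.
move=> PD A B; move: {2}#|A :\: B| (leqnn #|A :\: B|) => m.
elim: m A => [|m IH] A cAB PA eD cA.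
  have : A \subset B by rewrite -setD_eq0 -cards_eq0 -leqn0.
  by move=> AB; have /eqP <- : A == B by rewrite eqEcard AB cA leqnn.
have [|AB0] := posnP #|A :\: B|; first by move=> c0; apply: (IH A); rewrite ?c0.
have BA0 : 0 < #|B :\: A|.
  by move: AB0; rewrite !cardsD cA setIC.
case/card_gt0P: AB0 => a; rewrite inE => /andP[aB aA].
case/card_gt0P: BA0 => x; rewrite inE => /andP[xA xB].
have aD : a \in D.
  by move/setP/(_ a): eD; rewrite !inE aA (negPf aB) andbT andbF => /negbFE.
have xD : x \in D.
  by move/setP/(_ x): eD; rewrite !inE xB (negPf xA) andbT andbF => /esym/negbFE.
apply: (IH (swap A a x)); rewrite ?card_swap //; last 2 first.
- exact: PD.
- rewrite -eD; apply/setP => y; rewrite !inE.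
  have [->|ya] := eqVneq y a; first by rewrite aD.
  by have [->|yx] //= := eqVneq y x; rewrite xD.
have := card_swapI (~: B) aA xA; rewrite !inE aB xB /= -!setDE; lia.
Qed.

Lemma exists_subset_card (T : finType) (S : {set T}) (r : nat) : r <= #|S| ->
  exists2 Z : {set T}, Z \subset S & #|Z| = r.
Proof.
rewrite -bin_gt0 -cards_draws => /card_gt0P[Z]; rewrite inE => /andP[ZS /eqP cZ].
by exists Z.
Qed.

(* With |M| = 2 * r + 2, the case r = 0 is the 2-star and r = 1 the exceptional family. *)
Definition frankl (T : finType) (k r : nat) (M : {set T}) : {set {set T}} :=
  [set S : {set T} | (#|S| == k) && (r + 2 <= #|S :&: M|)].

Lemma frankl_two_intersecting (T : finType) (k r : nat) (M : {set T}) :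
  #|M| = 2 * r + 2 -> two_intersecting (frankl k r M).
Proof.
move=> cM A B; rewrite !inE => /andP[_ cA] /andP[_ cB].
have := cardsUI (A :&: M) (B :&: M).
have : #|(A :&: M) :|: (B :&: M)| <= #|M| by apply: subset_leq_card; rewrite subUset !subsetIr.
have : #|(A :&: M) :&: (B :&: M)| <= #|A :&: B|.
  by apply: subset_leq_card; rewrite setIACA subsetIl.
lia.
Qed.

Lemma two_intersecting_neq1 (T : finType) (F : {set {set T}}) :
  two_intersecting F -> {in F &, forall A B : {set T}, #|A :&: B| != 1}.
Proof. by move=> F2 A B AF BF; have := F2 A B AF BF; lia. Qed.

(** If [U] met [M] in at most r + 1 points, take r + 1 points of [M] outside [U], one more point [z]
    of [M], and fill up outside both sets. The result is in [F] and shares at most [z] with [U]. *)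
Lemma subset_frankl (T : finType) (e k r : nat) (M : {set T}) (F : {set {set T}}) :
  #|T| = 2 * k + e -> k <= e + 3 -> #|M| = 2 * r + 2 -> r + 2 <= k ->
  uniform k F -> two_intersecting F ->
  (forall B : {set T}, #|B| = k -> #|B :&: M| = r + 2 -> B \in F) ->
  F \subset frankl k r M.
Proof.
move=> cT ke cM rk uF F2 FM; apply/subsetP => U UF; rewrite inE uF // eqxx /=.
rewrite leqNgt; apply/negP => UM.
have cMU : r + 1 <= #|M :\: U| by rewrite cardsD setIC cM; lia.
have [W WMU cW] := exists_subset_card cMU.
have [z zM zW] : exists2 z, z \in M & z \notin W.
  apply/subsetPn; apply/negP => /subset_leq_card; lia.
have cUM : #|U :|: M| + #|U :&: M| = k + (2 * r + 2) by rewrite cardsUI uF // cM.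
have : k - r - 2 <= #|~: (U :|: M)|.
  rewrite cardsCs setCK cT; lia.
case/exists_subset_card => Z ZUM cZ.
have WM : W \subset M by apply: subset_trans WMU (subsetDl _ _).
have dZ y : y \in Z -> (y \notin U) && (y \notin M).
  by move/(subsetP ZUM); rewrite !inE negb_or.
have BM : ((z |: W) :|: Z) :&: M = z |: W.
  apply/setP => y; rewrite !inE; have [->|yz] := eqVneq y z; first by rewrite zM.
  case yW: (y \in W) => /=; first by rewrite (subsetP WM).
  by apply/negP => /andP[/dZ/andP[_ /negPf ->]].
have czW : #|z |: W| = r + 2 by rewrite cardsU1 zW cW; lia.
have BF : (z |: W) :|: Z \in F.
  apply: FM; last by rewrite BM.
  rewrite cardsU (_ : _ :&: Z = set0) ?cards0 ?czW ?cZ; first by lia.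
  apply/setP => y; rewrite !inE; apply/negP => /andP[yzW /dZ/andP[_]].
  by case/predU1P: yzW => [->|/(subsetP WM) ->]; rewrite ?zM.
have := F2 _ _ BF UF; apply/negP; rewrite -ltnNge ltnS.
rewrite -(cards1 z); apply: subset_leq_card; apply/subsetP => y; rewrite !inE.
case/andP => /orP[/predU1P[->//|yW] yU|/dZ/andP[/negPf ->]//].
by have := subsetP WMU _ yW; rewrite !inE yU.
Qed.

Lemma bin_double (e r : nat) : r <= e -> 2 * 'C(r + e + 1, r) <= 'C(r.+1 + e + 1, r.+1).
Proof.
move=> re; rewrite -(leq_pmul2l (ltn0Sn r)).
have := mul_bin_diag (r.+1 + e + 1) r; rewrite !addSn /= => <-.
by rewrite mulnA leq_mul2r; apply/orP; right; lia.
Qed.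

Lemma bin_double_iter (e r u : nat) : r + u <= e + 1 ->
  2 ^ u * 'C(r + e + 1, r) <= 'C(r + u + e + 1, r + u).
Proof.
elim: u => [|u IH] ru; first by rewrite addn0 mul1n.
have le1 : r + u <= e by lia.
rewrite (addnS r u) expnS -mulnA; apply: leq_trans (bin_double le1).
by rewrite leq_mul2l IH ?orbT //; lia.
Qed.

Definition balanced (T : finType) (e k : nat) (F : {set {set T}}) : Prop :=
  forall S : {set T}, #|S| = k -> S \notin F -> {in F, forall X : {set T}, 0 < #|X :&: S|} ->
    #|[set X in F | #|X :&: S| == 1]| = 'C(k + e - 1, k - 2).

Definition compressed (n : nat) (F : {set {set 'I_n}}) : Prop :=
  forall (A : {set 'I_n}) (j i : 'I_n), A \in F -> j \in A -> i \notin A -> i < j ->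
    swap A j i \in F.

Definition below (n : nat) (s : 'I_n) : {set 'I_n} := [set x : 'I_n | x < s].

(* The members of F counted by [balanced] for the set A - s + y contain every
   element below s missing from A, exactly one further element b of A below s,
   and are arbitrary above s, which bounds their number.  Each of them can play
   the role of A in turn. *)
Lemma pivot_family (n e k : nat) (F : {set {set 'I_n}}) (s : 'I_n) (A : {set 'I_n}) (y : 'I_n) :
  n = 2 * k + e -> 3 <= k -> uniform k F -> two_intersecting F -> balanced e k F ->
  compressed F ->
  (forall (B : {set 'I_n}) (a x : 'I_n), B \in F -> a \in B -> x \notin B ->
     s < a -> s < x -> swap B a x \in F) ->
  A \in F -> s \in A -> y \notin A -> s < y -> swap A s y \notin F ->
  exists beta : {set 'I_n}, [/\ beta \subset A :&: below s, 0 < #|beta|,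
    #|below s :\: A| + 2 <= k,
    'C(k + e - 1, k - 2) <=
      #|beta| * 'C(k + e - 1 - #|below s :\: A|, k - 2 - #|below s :\: A|) &
    forall b, b \in beta -> exists X : {set 'I_n},
      [/\ X \in F, s \in X, y \notin X, swap X s y \notin F &
          X :&: below s = b |: (below s :\: A)]].
Proof.
move=> nE k3 uF F2 bF cF Fs AF sA yA sy AyF.
set L := below s; set u := #|L :\: A|; pose D := [set x : 'I_n | s < x].
pose TT := [set X in F | #|X :&: swap A s y| == 1].
have XAy (X : {set 'I_n}) : #|X :&: swap A s y| + (s \in X) = #|X :&: A| + (y \in X).
  by rewrite !(setIC X) card_swapI.
have cTT : #|TT| = 'C(k + e - 1, k - 2).
  apply: bF; rewrite ?card_swap ?uF // => X XF.
  by have := XAy X; have := F2 X A XF AF; case: (s \in X); case: (y \in X); clear; lia.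
(* Trading s for y lowers the intersection from at least 2 to 1. *)
have TT1 (X : {set 'I_n}) : X \in TT -> [/\ X \in F, s \in X, y \notin X & #|X :&: A| = 2].
  rewrite inE => /andP[XF /eqP c]; have := XAy X; have := F2 X A XF AF.
  by rewrite c XF; case: (s \in X); case: (y \in X) => //= h1 h2; split=> //; move: h1 h2; clear; lia.
have TTL (X : {set 'I_n}) x : X \in TT -> x \in L -> x \notin A -> x \in X.
  move=> /TT1[XF sX yX cX]; rewrite inE => xs xA.
  have xAF : swap A s x \in F by apply: cF.
  have := F2 _ _ xAF XF; have := card_swapI X sA xA; rewrite sX (setIC A) cX.
  by case: (x \in X); clear; lia.
(* If b were above s, then X - b + y would be in [F] and meet [A] in one point. *)
have TTA (X : {set 'I_n}) b : X \in TT -> b \in X -> b \in A -> b != s -> b \in L.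
  move=> /TT1[XF sX yX cX] bX bA bs; rewrite inE ltnNge; apply/negP => sb.
  have sb' : s < b by rewrite ltn_neqAle sb andbT eq_sym.
  have XbF := Fs X b y XF bX yX sb' sy.
  have := F2 _ _ XbF AF; have := card_swapI A bX yX.
  by rewrite bA (negPf yA) cX; clear; lia.
have TT2 (X : {set 'I_n}) : X \in TT -> exists2 b, b \in A :&: L & X :&: (A :&: L) = [set b].
  move=> XT; have [XF sX yX cX] := TT1 X XT.
  have : #|X :&: (A :&: L)| == 1.
    move: cX; rewrite (cardsD1 s) inE sX sA /= add1n => -[<-]; apply/eqP.
    apply: eq_card => z; rewrite !inE; have [->|zs] /= := eqVneq z s; first by rewrite ltnn !andbF.
    case: (boolP (z \in X)) => //= zX; case: (boolP (z \in A)) => //= zA.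
    by have := TTA X z XT zX zA zs; rewrite inE => ->.
  by case/cards1P => b eb; exists b => //; have := set11 b; rewrite -eb => /setIP[].
pose beta := [set b in A :&: L | [exists X in TT, b \in X]].
have XLE (X : {set 'I_n}) : X \in TT -> X :&: L = (X :&: (A :&: L)) :|: (L :\: A).
  move=> XT; apply/setP => z; rewrite !inE; case zs: (z < s); rewrite ?andbF ?andbT //=.
  case: (boolP (z \in A)) => zA; rewrite ?andbT ?orbF ?andbF //.
  by apply: (TTL X) => //; rewrite inE.
have cXL (X : {set 'I_n}) : X \in TT -> #|X :&: L| = u + 1.
  move=> XT; rewrite XLE //; have [b bAL ->] := TT2 X XT.
  have bA : b \in A by case/setIP: bAL.
  by rewrite cardsU1 !inE bA /= addnC.
have XE (X : {set 'I_n}) : X \in TT -> X = (X :&: L) :|: (s |: (X :&: D)).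
  move=> /TT1[XF sX _ _]; apply/setP => z; rewrite !inE -val_eqE /=.
  by case: (ltngtP z s) => [||/val_inj ->]; rewrite ?andbT ?andbF ?orbF ?orbT ?sX.
have cXD (X : {set 'I_n}) : X \in TT -> u + 2 + #|X :&: D| = k.
  move=> XT; have [XF _ _ _] := TT1 X XT; rewrite -(uF X XF) [in RHS](XE X XT).
  rewrite cardsU cXL // cardsU1 !inE ltnn andbF /=.
  have -> : (X :&: L) :&: (s |: (X :&: D)) = set0.
    apply/setP => z; rewrite !inE -val_eqE /=.
    by case: (ltngtP z s); rewrite ?andbF ?andbT.
  by rewrite cards0; lia.
have TT0 : 0 < #|TT| by rewrite cTT bin_gt0; lia.
have [X0 X0T] : exists X, X \in TT by apply/card_gt0P.
exists beta; split.
- by apply/subsetP => b; rewrite inE => /andP[].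
- have [b bAL eb] := TT2 X0 X0T; apply/card_gt0P; exists b; rewrite inE bAL /=.
  by apply/existsP; exists X0; rewrite X0T; have := set11 b; rewrite -eb inE => /andP[].
- by have := cXD X0 X0T; rewrite -/u; lia.
- have cD : #|D :\: (y |: A)| = k + e - 1 - u.
    have : #|D :\: A| = (y \in D :\: A) + #|D :\: (y |: A)|.
      rewrite (cardsD1 y); congr (_ + #|pred_of_set _|).
      by apply/setP => z; rewrite !inE negb_or andbA.
    have : #|~: A| = #|L :\: A| + #|D :\: A|.
      rewrite -[LHS](cardsID L); congr (_ + _).
        by apply: eq_card => z; rewrite !inE andbC.
      apply: eq_card => z; rewrite !inE.
      by case: (ltngtP z s) => [||/val_inj ->]; rewrite ?sA ?andbT ?andbF.
    rewrite !inE yA sy /= cardsCs setCK card_ord uF // -/u; lia.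
  (* A counted set is determined by its point of [beta] and its part above s, a subset of
     [D :\: (y |: A)] of size k - 2 - u. *)
  pose g (X : {set 'I_n}) := (X :&: (A :&: L), X :&: D).
  have cg : #|g @: TT| = #|TT|.
    apply: card_in_imset => X Y XT YT [e1 e2].
    by rewrite (XE X XT) (XE Y YT) (XLE X XT) (XLE Y YT) e1 e2.
  rewrite -cTT -cg -(card_imset beta (@set1_inj _)) -cD -cards_draws -cardsX.
  apply: subset_leq_card; apply/subsetP => _ /imsetP[X XT ->]; rewrite !inE /=.
  have [XF sX yX cX] := TT1 X XT; have [b bAL eb] := TT2 X XT.
  apply/and3P; split.
  + rewrite eb; apply: imset_f; rewrite inE bAL /=; apply/existsP; exists X.
    by rewrite XT; have := set11 b; rewrite -eb inE => /andP[].
  + apply/subsetP => z; rewrite !inE => /andP[zX sz]; rewrite sz andbT negb_or.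
    apply/andP; split; first by apply: contraNneq yX => <-.
    apply/negP => zA; have zs : z != s by apply: contraTneq sz => ->; rewrite ltnn.
    by have := TTA X z XT zX zA zs; rewrite inE => /(ltn_trans sz); rewrite ltnn.
  + by rewrite -(cXD X XT) -subnDA [2 + u]addnC addKn.
move=> b; rewrite inE => /andP[bAL /existsP[X /andP[XT bX]]].
have [XF sX yX cX] := TT1 X XT; exists X; split=> //.
  apply/negP => XyF; have := F2 _ _ XyF AF; have := card_swapI A sX yX.
  by rewrite sA (negPf yA) cX; clear; lia.
rewrite -/L XLE //; have [b' _ eb] := TT2 X XT.
by have : b \in [set b'] by [rewrite -eb inE bX bAL]; rewrite inE => /eqP ->; rewrite eb.
Qed.

(** Raising both arguments of C(r + e + 1, r) by one at least doubles it while r <= e, and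
    [k <= e + 3] permits u such steps. *)
Lemma exp2_le_of_bin (e k u b : nat) : 2 <= k -> k <= e + 3 -> u + 2 <= k ->
  'C(k + e - 1, k - 2) <= b * 'C(k + e - 1 - u, k - 2 - u) -> 2 ^ u <= b.
Proof.
move=> k2 ke uk; have [r kE] : exists r, k = r + u + 2 by exists (k - 2 - u); lia.
have -> : k + e - 1 = r + u + e + 1 by lia.
have -> : r + u + e + 1 - u = r + e + 1 by lia.
have -> : k - 2 = r + u by lia.
rewrite addnK => le1; have ru : r + u <= e + 1 by lia.
have := leq_trans (bin_double_iter ru) le1.
by rewrite leq_pmul2r // bin_gt0; lia.
Qed.

(** Since m < 2^m, the hypotheses give i = u + 1, and 2^u <= u + 1 leaves u <= 1. *)
Lemma exp2_mutual (u i : nat) : 0 < i -> 2 ^ u <= i -> 2 ^ (i - 1) <= u + 1 ->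
  (u = 0 /\ i = 1) \/ (u = 1 /\ i = 2).
Proof.
move=> i0 ui iu; have := ltn_expl u (isT : 1 < 2); have := ltn_expl (i - 1) (isT : 1 < 2).
move=> h1 h2; have {i0} iE : i = u + 1 by lia.
case: u ui {iu h1 h2} iE => [|[|u]] ui iE; [by left; lia | by right; lia | exfalso].
have := ltn_expl u.+1 (isT : 1 < 2); rewrite expnS in ui; lia.
Qed.

(** Absorption reduces the inequality to k + e - 1 <= 2 (k - 2). *)
Lemma bin_le_double (e k b : nat) : 3 <= k -> b <= 2 ->
  'C(k + e - 1, k - 2) <= b * 'C(k + e - 1 - 1, k - 2 - 1) -> e + 3 <= k.
Proof.
move=> k3 b2; have [r kE] : exists r, k = r + 3 by exists (k - 3); lia.
have -> : k + e - 1 - 1 = r + e + 1 by lia.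
have -> : k + e - 1 = (r + e + 1).+1 by lia.
have -> : k - 2 - 1 = r by lia.
have -> : k - 2 = r.+1 by lia.
rewrite -(leq_pmul2l (ltn0Sn r)) -mul_bin_diag /= mulnA leq_pmul2r; last by rewrite bin_gt0; lia.
have := leq_mul (leqnn r.+1) b2; lia.
Qed.

(** Here [M] is s with everything below it. By maximality of s, membership of a k-set in [F] depends
    only on its trace on [M], so one member of [F] for each trace of size r + 2 is enough. *)
Lemma compressed_generators (n e k : nat) (F : {set {set 'I_n}}) :
  n = 2 * k + e -> 3 <= k -> k <= e + 3 -> uniform k F -> two_intersecting F ->
  balanced e k F -> compressed F -> F != set0 ->
  exists r, exists M : {set 'I_n}, [/\ r <= 1, r = 1 -> k = e + 3, #|M| = 2 * r + 2 &
    forall B : {set 'I_n}, #|B| = k -> #|B :&: M| = r + 2 -> B \in F].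
Proof.
move=> nE k3 ke uF F2 bF cF /set0Pn[A0 A0F].
pose bad (s : 'I_n) := [exists A in F, [exists y : 'I_n,
  [&& s \in A, s < y, y \notin A & swap A s y \notin F]]].
have badN (A : {set 'I_n}) (s y : 'I_n) : ~~ bad s -> A \in F -> s \in A -> s < y -> y \notin A ->
    swap A s y \in F.
  move=> bs AF sA sy yA; apply: contraNT bs => sw; apply/existsP; exists A.
  by rewrite AF /=; apply/existsP; exists y; apply/and4P.
(* Otherwise [F] is closed under all swaps and contains a k-set disjoint from [A0]. *)
have [s0 bad0] : exists s, bad s.
  apply/existsP; apply: contraT; rewrite negb_exists => /forallP nbad.
  have all_swap (A : {set 'I_n}) (a x : 'I_n) : A \in F -> a \in A -> x \notin A -> swap A a x \in F.
    move=> AF aA xA; have [ax|xa|/val_inj ax] := ltngtP a x; first exact: badN.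
      exact: cF.
    by rewrite -ax aA in xA.
  have : k <= #|~: A0| by rewrite cardsCs setCK card_ord uF //; lia.
  case/exists_subset_card => B BA cB.
  have BF : B \in F.
    apply: (swap_connected (P := fun X => X \in F) (D := setT) _ A0F); rewrite ?setDT ?cB ?uF //.
    by move=> A a x AF aA xA _ _; apply: all_swap.
  have := F2 _ _ A0F BF; rewrite (_ : A0 :&: B = set0) ?cards0 //.
  by apply/eqP; rewrite setIC setI_eq0 disjoints_subset.
have [s bs smax] := arg_maxnP (fun s : 'I_n => nat_of_ord s) bad0.
have Fs (B : {set 'I_n}) (a x : 'I_n) : B \in F -> a \in B -> x \notin B ->
     s < a -> s < x -> swap B a x \in F.
  move=> BF aB xB sa sx; have [ax|xa|/val_inj ax] := ltngtP a x.
  - by apply: badN => //; apply/negP => /smax; rewrite /= leqNgt sa.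
  - exact: cF.
  - by rewrite -ax aB in xB.
have traceF (B C : {set 'I_n}) : B \in F -> #|C| = k ->
    B :&: (s |: below s) = C :&: (s |: below s) -> C \in F.
  move=> BF cC eBC; pose D := [set x : 'I_n | s < x].
  apply: (swap_connected (P := fun X => X \in F) (D := D) _ BF); last by rewrite uF.
    by move=> X a x XF aX xX; rewrite !inE => sa sx; apply: Fs.
  have eD (X : {set 'I_n}) : X :\: D = X :&: (s |: below s).
    by apply/setP => z; rewrite !inE -leqNgt leq_eqVlt andbC.
  by rewrite !eD.
have /existsP[A /andP[AF /existsP[y /and4P[sA sy yA AyF]]]] := bs.
have [beta [bsub b0 uk cle bX]] := pivot_family nE k3 uF F2 bF cF Fs AF sA yA sy AyF.
set L := below s in bsub uk cle bX traceF *; set M := s |: L in traceF *.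
have sL : s \notin L by rewrite inE ltnn.
have cM : #|M| = 1 + #|L| by rewrite cardsU1 sL.
have cIM (X : {set 'I_n}) : s \in X -> #|X :&: M| = 1 + #|X :&: L|.
  move=> sX; rewrite (cardsD1 s) !inE sX eqxx; congr (_ + _); apply: eq_card => z; rewrite !inE.
  by have [->|zs] //= := eqVneq z s; rewrite ltnn andbF.
have cL : #|A :&: L| + #|L :\: A| = #|L| by rewrite setIC cardsID.
have bi := subset_leq_card bsub.
have le_u : 2 ^ #|L :\: A| <= #|beta| := exp2_le_of_bin (ltnW k3) ke uk cle.
have bXc (b : 'I_n) (X : {set 'I_n}) : b \in beta -> X :&: L = b |: (L :\: A) ->
    #|X :&: L| = 1 + #|L :\: A|.
  move=> bb ->; rewrite cardsU1 inE; by have /setIP[-> _] := subsetP bsub _ bb.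
have le_i : 2 ^ (#|A :&: L| - 1) <= #|L :\: A| + 1.
  have [b bb] : exists b, b \in beta by apply/card_gt0P.
  have [X [XF sX yX XyF XL]] := bX b bb.
  have [beta' [bsub' b0' uk' cle' _]] := pivot_family nE k3 uF F2 bF cF Fs XF sX yX sy XyF.
  have cX := bXc b X bb XL.
  have := cardsID X L; rewrite setIC cX => cLX.
  (* [X] contains one more element below s than [A] misses, hence misses one fewer than [A]
     contains. *)
  have -> : #|A :&: L| - 1 = #|L :\: X|.
    by rewrite -(addKn (1 + #|L :\: A|) #|L :\: X|) cLX -cL [1 + _]addnC subnDA addnK.
  rewrite addnC -cX; apply: leq_trans (subset_leq_card bsub').
  exact: exp2_le_of_bin (ltnW k3) ke uk' cle'.
have i0 : 0 < #|A :&: L| by apply: leq_trans bi.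
have [[u0 i1]|[u1 i2]] := exp2_mutual i0 (leq_trans le_u bi) le_i.
  exists 0, M; split=> //; first by rewrite cM -cL u0 i1.
  move=> B cB BM; apply: (traceF A) => //.
  have full (X : {set 'I_n}) : #|X :&: M| = 2 -> X :&: M = M.
    by move=> cX; apply/eqP; rewrite eqEcard subsetIr cX cM -cL u0 i1.
  have cA : #|A :&: M| = 2 by rewrite (cIM A sA) i1.
  by rewrite -/M (full A cA) (full B BM).
have c4 : #|M| = 4 by rewrite cM -cL u1 i2.
exists 1, M; split=> // [_|B cB BM].
  apply/eqP; rewrite eqn_leq ke /=; rewrite u1 in cle.
  by apply: (bin_le_double k3 _ cle); rewrite -i2.
have [z zM zB] : exists2 z, z \in M & z \notin B.
  apply/subsetPn; apply/negP => /setIidPr MB; by move: BM; rewrite MB c4.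
(* A member with trace [M :\ z] is wanted: [A] if it misses z, A - s + c if z = s, and otherwise the
   set [X] of a [b] other than z. *)
have reach (X : {set 'I_n}) : X \in F -> #|X :&: M| = 3 -> z \notin X -> B \in F.
  move=> XF cX zX; apply: (traceF X) => //; rewrite -/M.
  have E (Y : {set 'I_n}) : #|Y :&: M| = 3 -> z \notin Y -> Y :&: M = M :\ z.
    move=> cY zY; apply/eqP; rewrite eqEcard subsetD1 subsetIr !inE (negPf zY) cY /=.
    by move: c4; rewrite (cardsD1 z) zM add1n => -[->].
  by rewrite (E X cX zX) (E B BM zB).
have [zA|zA] := boolP (z \in A); last by apply: (reach A) => //; rewrite (cIM A sA) i2.
have [zs|zs] := eqVneq z s.
  have [c cLA] : exists c, c \in L :\: A by apply/card_gt0P; rewrite u1.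
  have /setDP[cL' cA] := cLA.
  apply: (reach (swap A s c)).
  - by apply: cF => //; move: cL'; rewrite inE.
  - have := card_swapI M sA cA; rewrite (cIM A sA) i2.
    have -> : s \in M by rewrite setU11.
    have -> : c \in M by rewrite inE cL' orbT.
    exact: addIn.
  - by rewrite zs !inE eqxx orbF; apply: contraNneq cA => <-.
have [b bb bz] : exists2 b, b \in beta & b != z.
  have : 0 < #|beta :\ z|.
    move: le_u; rewrite u1 expn1 (cardsD1 z beta).
    by case: (z \in beta); rewrite ?add1n ?add0n //; apply: ltnW.
  by case/card_gt0P => b; rewrite !inE => /andP[]; exists b.
have [X [XF sX yX XyF XL]] := bX b bb.
apply: (reach X) => //; first by rewrite (cIM X sX) (bXc b X bb XL) u1.
apply/negP => zX; have : z \in X :&: L.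
  by rewrite inE zX; move: zM; rewrite !inE (negPf zs).
by rewrite XL !inE eq_sym (negPf bz) zA.
Qed.

(** * Undoing a shift *)

Definition shift_set (T : finType) (F : {set {set T}}) (j i : T) (A : {set T}) : {set T} :=
  if [&& j \in A, i \notin A & swap A j i \notin F] then swap A j i else A.

Definition shift (T : finType) (F : {set {set T}}) (j i : T) : {set {set T}} :=
  shift_set F j i @: F.

Lemma mem_swap_new (T : finType) (A : {set T}) (a x : T) : x \in swap A a x.
Proof. by rewrite !inE eqxx. Qed.

Lemma mem_swap_old (T : finType) (A : {set T}) (a x : T) : a \in A -> x \notin A ->
  a \notin swap A a x.
Proof. by move=> aA xA; rewrite !inE eqxx orbF; apply: contraNneq xA => <-. Qed.

Lemma shift_set_inj (T : finType) (F : {set {set T}}) (j i : T) :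
  {in F &, injective (shift_set F j i)}.
Proof.
move=> A B AF BF; rewrite /shift_set.
case: ifP => [/and3P[jA iA sA]|_]; case: ifP => [/and3P[jB iB sB]|_] // e.
- by rewrite -(swapK jA iA) -(swapK jB iB) e.
- by rewrite e BF in sA.
- by rewrite -e AF in sB.
Qed.

Lemma card_shift (T : finType) (F : {set {set T}}) (j i : T) : #|shift F j i| = #|F|.
Proof. exact/card_in_imset/shift_set_inj. Qed.

Lemma uniform_shift (T : finType) (k : nat) (F : {set {set T}}) (j i : T) :
  uniform k F -> uniform k (shift F j i).
Proof.
move=> uF _ /imsetP[A AF ->]; rewrite /shift_set.
by case: ifP => [/and3P[jA iA _]|_]; rewrite ?card_swap // uF.
Qed.

(** The delicate case is that [A] moves while [B] stays because its image is already in [F]. Then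
    [A] meets that image in two points, hence [B] in three, and may lose j. *)
Lemma two_intersecting_shift (T : finType) (F : {set {set T}}) (j i : T) :
  two_intersecting F -> two_intersecting (shift F j i).
Proof.
move=> F2.
have mixed (A B : {set T}) : A \in F -> B \in F -> j \in A -> i \notin A ->
    ~~ [&& j \in B, i \notin B & swap B j i \notin F] -> 2 <= #|swap A j i :&: B|.
  move=> AF BF jA iA nB; have := F2 A B AF BF; have := card_swapI B jA iA.
  case: (boolP (j \in B)) nB => jB; last by case: (i \in B); clear; lia.
  case: (boolP (i \in B)) => iB //=; first by clear; lia.
  rewrite negbK => sBF; have := F2 A _ AF sBF; have := card_swapI A jB iB.
  by rewrite jA (negPf iA) !(setIC _ A); clear; lia.
move=> _ _ /imsetP[A AF ->] /imsetP[B BF ->]; rewrite /shift_set.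
case: ifP => [/and3P[jA iA sA]|/negbT nA]; case: ifP => [/and3P[jB iB sB]|/negbT nB].
- have := F2 A B AF BF; have := card_swapI (swap B j i) jA iA.
  rewrite mem_swap_new (negPf (mem_swap_old jB iB)).
  have := card_swapI A jB iB; rewrite jA (negPf iA) !(setIC _ A); clear; lia.
- exact: mixed.
- by rewrite setIC; apply: mixed.
- exact: F2.
Qed.

Lemma shift_from (T : finType) (F : {set {set T}}) (j i : T) (A : {set T}) : A \in F ->
  A \in shift F j i \/
  [/\ j \in A, i \notin A, swap A j i \notin F & swap A j i \in shift F j i].
Proof.
move=> AF; have : shift_set F j i A \in shift F j i := imset_f _ AF.
rewrite {1}/shift_set.
by case: ifP => [/and3P[jA iA sA] sF|_ sF]; [right | left].
Qed.

Lemma shift_to (T : finType) (F : {set {set T}}) (j i : T) (A : {set T}) :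
  A \in shift F j i -> i \in A -> j \notin A -> A \in F \/ swap A i j \in F.
Proof.
move=> /imsetP[B BF ->]; rewrite /shift_set.
by case: ifP => [/and3P[jB iB _] _ _|]; [right; rewrite swapK | left].
Qed.

Lemma shift_both (T : finType) (F : {set {set T}}) (j i : T) (A : {set T}) :
  A \in F -> i \in A -> j \notin A -> swap A i j \in F -> swap A i j \in shift F j i.
Proof.
move=> AF iA jA sF; apply/imsetP; exists (swap A i j) => //; rewrite /shift_set.
by rewrite swapK // AF !andbF.
Qed.

Lemma shift_closed (T : finType) (F : {set {set T}}) (j i : T) (A : {set T}) :
  A \in shift F j i -> j \in A -> i \notin A -> swap A j i \in shift F j i.
Proof.
move=> /imsetP[B BF ->]; rewrite /shift_set.
case: ifP => [/and3P[jB iB _]|nB]; first by rewrite (negPf (mem_swap_old jB iB)).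
move=> jB iB; move: nB; rewrite jB iB /= => /negbFE sF.
apply/imsetP; exists (swap B j i) => //.
by rewrite /shift_set (negPf (mem_swap_old jB iB)).
Qed.

(* The k-sets on which a family and its shift of j to i may differ, when the
   shift is [frankl k r M] with i in M and j outside M. *)
Definition critical (T : finType) (k r : nat) (M : {set T}) (i j : T) (U : {set T}) : bool :=
  [&& #|U| == k, i \in U, j \notin U & #|U :&: M| == r + 2].

(** Two critical sets one swap apart, with both swapped elements in [M] or both outside, have a
    common critical neighbour meeting each in two points. Such swaps connect all critical sets. *)
Lemma critical_connected (T : finType) (e k r : nat) (M : {set T}) (i j : T)
    (F : {set {set T}}) :
  #|T| = 2 * k + e -> k <= e + 3 -> 3 <= k -> #|M| = 2 * r + 2 -> i \in M -> j \notin M ->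
  (forall U W : {set T}, critical k r M i j U -> critical k r M i j W -> #|U :&: W| = 2 ->
     U \in F -> W \in F) ->
  forall U W : {set T}, critical k r M i j U -> critical k r M i j W -> U \in F -> W \in F.
Proof.
move=> cT ke k3 cM iM jM adj.
have step (U : {set T}) (a x : T) : critical k r M i j U && (U \in F) -> a \in U -> x \notin U ->
    (a \in M) = (x \in M) -> a != i -> x != j -> critical k r M i j (swap U a x) && (swap U a x \in F).
  case/andP=> cU UF aU xU aMx ai xj; have /and4P[/eqP kU iU jU /eqP MU] := cU.
  have cU2 : critical k r M i j (swap U a x).
    apply/and4P; split; rewrite ?card_swap ?kU //.
    - by rewrite !inE iU andbT (eq_sym i a) ai orbT.
    - by rewrite !inE negb_or eq_sym xj (negPf jU) andbF.
    - by have := card_swapI M aU xU; rewrite aMx => /addIn ->; rewrite MU.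
  rewrite cU2 /=.
  have cUM' : #|(U :&: M) :\ i| = r + 1.
    by move: MU; rewrite (cardsD1 i) inE iU iM; clear; lia.
  (* With p = a for a in [M], the neighbour [W] contains both a and x; otherwise it avoids both.
     Either way the swap keeps the intersection size with [W]. *)
  have [p pUM pa] : exists2 p, p \in (U :&: M) :\ i & a \in M -> p = a.
    case: (boolP (a \in M)) => aM; first by exists a; rewrite // !inE ai aU aM.
    by have /card_gt0P[p pP] : 0 < #|(U :&: M) :\ i|; [rewrite cUM' addn1 | exists p].
  have {pUM} [pi pU pM] : [/\ p != i, p \in U & p \in M].
    by move: pUM; rewrite !inE => /and3P[].
  have rk : r + 2 <= k by rewrite -MU -kU subset_leq_card // subsetIl.
  have cbig : #|j |: (x |: (M :|: U))| + (r + 2) <= 2 + (k + (2 * r + 2)).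
    have := cardsUI M U; rewrite (setIC M U) MU cM kU !cardsU1.
    by case: (j \notin _); case: (x \notin _); clear; lia.
  have : k - r - 2 <= #|~: (j |: (x |: (M :|: U)))|.
    rewrite cardsCs setCK cT; move: cbig ke k3 rk; clear; lia.
  case/exists_subset_card => Z ZS cZ.
  have dZ y : y \in Z -> [&& y != j, y != x, y \notin M & y \notin U].
    by move/(subsetP ZS); rewrite !inE !negb_or.
  pose N := i |: (p |: (M :\: U)).
  have NM : N \subset M by rewrite !subUset !sub1set iM pM subsetDl.
  have cN : #|N| = r + 2.
    rewrite !cardsU1 !inE iU pU !orbF eq_sym pi cardsD setIC MU cM; clear; lia.
  have NZ0 : N :&: Z = set0.
    apply/setP => y; rewrite [LHS]inE in_set0; apply/negP => /andP[/(subsetP NM) yM /dZ/and4P[_ _]].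
    by rewrite yM.
  pose W := N :|: Z.
  have WM : W :&: M = N.
    rewrite setIUl (setIidPl NM) (_ : Z :&: M = set0) ?setU0 //.
    by apply/setP => y; rewrite !inE; apply/negP => /andP[/dZ/and4P[_ _ /negPf ->]].
  have cW : critical k r M i j W.
    apply/and4P; split.
    - by rewrite cardsU NZ0 cards0 cN cZ; move: rk; clear; lia.
    - by rewrite !inE eqxx.
    - rewrite inE negb_or; apply/andP; split; first by apply: contraNN jM => /(subsetP NM).
      by apply/negP => /dZ/and4P[]; rewrite eqxx.
    - by rewrite WM cN.
  have UW : U :&: W = [set i; p].
    apply/setP => y; rewrite !inE; have [->|yi] := eqVneq y i; first by rewrite iU.
    have [->|yp] /= := eqVneq y p; first by rewrite pU.
    case yU: (y \in U) => //=; apply/negP => /dZ/and4P[_ _ _]; by rewrite yU.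
  have WF : W \in F by apply: (adj U) => //; rewrite UW cards2 eq_sym pi.
  apply: (adj W) => //; rewrite setIC.
  have xWa : (a \in W) = (x \in W).
    rewrite !inE; case: (boolP (a \in M)) => aM.
      rewrite (pa aM) eqxx orbT /=; apply/esym.
      by rewrite -aMx aM xU /= !orbT.
    have -> : (a \in Z) = false by apply/negP => /dZ/and4P[_ _ _]; rewrite aU.
    have -> : (x \in Z) = false by apply/negP => /dZ/and4P[_]; rewrite eqxx.
    rewrite -aMx (negPf aM) !andbF !orbF (negPf ai) /=.
    have -> : (x == i) = false by apply/negP => /eqP xi; rewrite xi iU in xU.
    have -> : (x == p) = false by apply/negP => /eqP xp; rewrite xp pU in xU.
    by apply/negP => /eqP ap; rewrite ap pM in aM.
  by have := card_swapI W aU xU; rewrite xWa => /addIn ->; rewrite UW cards2 eq_sym pi.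
move=> U W cU cW UF.
have /and4P[/eqP kU iU jU /eqP MU] := cU; have /and4P[/eqP kW iW jW /eqP MW] := cW.
(* From [U] to [V] only swaps inside [M] are needed, from [V] to [W] only swaps outside. *)
pose V := (U :\: M) :|: (W :&: M).
have kV : #|V| = k.
  rewrite cardsU (_ : (U :\: M) :&: (W :&: M) = set0); last first.
    by apply/setP => y; rewrite !inE; case: (y \in M); rewrite ?andbF.
  by rewrite cards0 subn0 MW -MU -kU addnC cardsID.
pose P := fun X : {set T} => critical k r M i j X && (X \in F) : Prop.
have PV : P V.
  apply: (swap_connected (P := P) (D := M :\ i) _ (A := U)); rewrite ?kV /P ?cU //.
    move=> A a x cA aA xA /setD1P[ai aM] /setD1P[xi xM]; apply: step => //; first by rewrite aM xM.
    by apply: contraNneq jM => <-.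
  apply/setP => y; rewrite !inE; have [->|yi] /= := eqVneq y i; first by rewrite iU iW iM.
  by case: (y \in M); rewrite ?andbF ?orbF.
suff /andP[] : P W by [].
apply: (swap_connected (P := P) (D := ~: (j |: M)) _ PV); last by rewrite kV.
  move=> A a x cA aA xA; rewrite !inE !negb_or => /andP[aj aM] /andP[xj xM].
  apply: step => //; first by rewrite (negPf aM) (negPf xM).
  by apply: contraNneq aM => ->.
apply/setP => y; rewrite !inE negbK; have [->|yj] /= := eqVneq y j.
  by rewrite (negPf jU) (negPf jW) (negPf jM).
by case: (y \in M); rewrite ?andbT.
Qed.

(** [coclique_bound] applies to the larger family as well. *)
Lemma subset_frankl_eq (T : finType) (e k r : nat) (M : {set T}) (F : {set {set T}}) :
  #|T| = 2 * k + e -> 3 <= k -> k <= e + 3 -> e.+1 < (k - 1) * (k - 2) ->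
  #|M| = 2 * r + 2 -> #|F| = 'C(#|T| - 2, k - 2) -> F \subset frankl k r M ->
  F = frankl k r M.
Proof.
move=> cT k3 ke ek cM cF sF; apply/eqP; rewrite eqEcard sF cF.
apply: (coclique_bound cT) => //; first by move=> A; rewrite inE => /andP[/eqP].
exact/two_intersecting_neq1/frankl_two_intersecting.
Qed.

(** The main case has i in [M] and j outside. If some critical set is in [F], all are, and [M]
    serves for [F]; if none is, [M] with i traded for j serves. *)
Lemma frankl_of_shift (T : finType) (e k r : nat) (M : {set T}) (F : {set {set T}}) (i j : T) :
  #|T| = 2 * k + e -> 3 <= k -> k <= e + 3 -> e.+1 < (k - 1) * (k - 2) ->
  #|M| = 2 * r + 2 -> uniform k F -> two_intersecting F ->
  #|F| = 'C(#|T| - 2, k - 2) -> shift F j i = frankl k r M ->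
  exists2 M' : {set T}, #|M'| = 2 * r + 2 & F = frankl k r M'.
Proof.
move=> cT k3 ke ek cM uF F2 cF sF.
have rk : r + 2 <= k.
  have : 0 < #|shift F j i| by rewrite card_shift cF bin_gt0 cT; move: k3; clear; lia.
  case/card_gt0P => S; rewrite sF inE => /andP[/eqP <- cSM].
  by apply: leq_trans cSM _; apply: subset_leq_card; apply: subsetIl.
have frF (A : {set T}) : A \in F -> r + 2 <= #|A :&: M| \/
    [/\ j \in A, i \notin A, swap A j i \notin F & r + 2 <= #|swap A j i :&: M|].
  move=> AF; have [|[jA iA sA]] := shift_from j i AF; rewrite sF inE => /andP[_ c].
    by left.
  by right.
have [ijM|ijM] := eqVneq (i \in M) (j \in M).
  exists M => //; apply: (subset_frankl_eq cT) => //; apply/subsetP => A AF.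
  rewrite inE uF // eqxx /=; have [//|[jA iA _]] := frF A AF.
  by have := card_swapI M jA iA; rewrite ijM => /addIn ->.
(* With j in [M] and i outside, a set with r + 2 points in [M], containing j but not i, would leave
   the family under a shift that preserves it. *)
have [iM|iM] := boolP (i \in M); last first.
  have jM : j \in M by move: ijM; rewrite (negPf iM); case: (j \in M).
  have : r + 1 <= #|M :\ j| by move: cM; rewrite (cardsD1 j) jM; clear; lia.
  case/exists_subset_card => N NM cN.
  have : k - r - 2 <= #|~: (i |: M)|.
    by rewrite cardsCs setCK cT cardsU1 iM cM; move: ke k3 rk; clear; lia.
  case/exists_subset_card => Z ZM cZ.
  have dN y : y \in N -> (y != j) && (y \in M) by move/(subsetP NM); rewrite !inE.
  have dZ y : y \in Z -> (y != i) && (y \notin M) by move/(subsetP ZM); rewrite !inE negb_or.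
  pose U := (j |: N) :|: Z.
  have UM : U :&: M = j |: N.
    apply/setP => y; rewrite !inE; have [->|yj] := eqVneq y j; first by rewrite jM.
    case yN: (y \in N) => /=; first by case/andP: (dN y yN).
    by apply/negP => /andP[/dZ/andP[_ /negPf ->]].
  have cUM : #|U :&: M| = r + 2.
    rewrite UM cardsU1 cN (_ : j \notin N); first by rewrite add1n -addSn addnC -addSnnS addnC.
    by apply/negP => /dN; rewrite eqxx.
  have kU : #|U| = k.
    rewrite -(cardsID M) cUM (_ : U :\: M = Z) ?cZ; first by move: rk; clear; lia.
    apply/setP => y; rewrite !inE; case yZ: (y \in Z); first by rewrite orbT andbT; case/andP: (dZ y yZ).
    rewrite orbF; have [->|yj] /= := eqVneq y j; first by rewrite jM.
    by apply/negP => /andP[yM /dN/andP[_]]; rewrite (negPf yM).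
  have jU : j \in U by rewrite !inE eqxx.
  have iU : i \notin U.
    rewrite !inE !negb_or -andbA; apply/and3P; split.
    - by apply: contraNneq iM => ->.
    - by apply: contra iM => /dN/andP[].
    - by apply/negP => /dZ; rewrite eqxx.
  have : U \in shift F j i by rewrite sF inE kU eqxx cUM leqnn.
  move/shift_closed/(_ jU iU); rewrite sF inE => /andP[_].
  by have := card_swapI M jU iU; rewrite jM (negPf iM) cUM; clear; lia.
have jM : j \notin M by move: ijM; rewrite iM; case: (j \in M).
have crit_move (U : {set T}) : critical k r M i j U -> U \in F -> swap U i j \notin F.
  case/and4P => [/eqP kU iU jU /eqP MU] UF; apply/negP => sUF.
  have := shift_both UF iU jU sUF; rewrite sF inE => /andP[_].
  by have := card_swapI M iU jU; rewrite iM (negPf jM) MU; clear; lia.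
have crit_shift (U : {set T}) : critical k r M i j U -> U \in F \/ swap U i j \in F.
  case/and4P => [/eqP kU iU jU /eqP MU]; apply: shift_to => //.
  by rewrite sF inE kU MU eqxx leqnn.
(* If [W] came from W - i + j, that set would be in [F] and meet [U] in one point. *)
have adj (U W : {set T}) : critical k r M i j U -> critical k r M i j W -> #|U :&: W| = 2 ->
     U \in F -> W \in F.
  move=> cU cW UW UF; have [//|sWF] := crit_shift W cW.
  have /and4P[_ iU jU _] := cU; have /and4P[_ iW jW _] := cW.
  have := F2 _ _ sWF UF; have := card_swapI U iW jW.
  by rewrite iU (negPf jU) setIC (setIC W) UW setIC; clear; lia.
have conn := critical_connected cT ke k3 cM iM jM adj.
have [/existsP[U /andP[cU UF]]|noU] := boolP [exists U in F, critical k r M i j U].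
  exists M => //; apply: (subset_frankl_eq cT) => //; apply/subsetP => A AF.
  rewrite inE uF // eqxx /=; have [//|[jA iA sA cA]] := frF A AF.
  rewrite leqNgt; apply/negP => AM.
  have crA : critical k r M i j (swap A j i).
    have := card_swapI M jA iA; rewrite iM (negPf jM) => eA.
    apply/and4P; split; rewrite ?card_swap ?(uF A AF) ?mem_swap_new ?mem_swap_old //.
    by move: eA AM cA; clear; lia.
  by rewrite (conn U _ UF crA cU) in sA.
exists (swap M i j); first by rewrite card_swap.
apply: (subset_frankl_eq cT) => //; first by rewrite card_swap.
apply/subsetP => A AF; rewrite inE uF // eqxx /= setIC.
have eM := card_swapI A iM jM; rewrite (setIC M) in eM.
have [cA|[jA iA _ cA]] := frF A AF; last first.
  by have := card_swapI M jA iA; move: eM cA; rewrite jA (negPf iA) iM (negPf jM); clear; lia.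
(* Not being critical, such a member has r + 3 points in [M] and can afford to lose i. *)
have [/andP[iA jA]|ijA] := boolP ((i \in A) && (j \notin A)).
  have nA : ~~ critical k r M i j A.
    by apply: contra noU => crA; apply/existsP; exists A; rewrite AF.
  move: nA eM cA; rewrite /critical uF // eqxx iA jA (negPf jA) /=; clear; lia.
by move: ijA eM cA; case: (i \in A); case: (j \in A) => //= _; clear; lia.
Qed.

(** * Compression by induction on the weight *)

Definition weight (n : nat) (F : {set {set 'I_n}}) : nat :=
  \sum_(A in F) \sum_(x in A) x.

Lemma weight_shift (n : nat) (F : {set {set 'I_n}}) (A : {set 'I_n}) (j i : 'I_n) :
  A \in F -> j \in A -> i \notin A -> i < j -> swap A j i \notin F ->
  weight (shift F j i) < weight F.
Proof.
move=> AF jA iA ij sA; rewrite /weight big_imset /=; last exact: shift_set_inj.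
have swap_lt (B : {set 'I_n}) : j \in B -> i \notin B ->
    \sum_(x in swap B j i) x < \sum_(x in B) x.
  move=> jB iB; rewrite big_setU1 /=; last by rewrite !inE (negPf iB) andbF.
  by rewrite [ltnRHS](big_setD1 j) //= ltn_add2r.
rewrite (bigD1 A) //= [ltnRHS](bigD1 A) //= -addSn; apply: leq_add.
  by rewrite /shift_set jA iA sA; apply: swap_lt.
apply: leq_sum => B _; rewrite /shift_set.
by case: ifP => [/and3P[jB iB _]|//]; apply/ltnW/swap_lt.
Qed.

Lemma tight_is_frankl (n e k : nat) (F : {set {set 'I_n}}) :
  n = 2 * k + e -> 3 <= k -> k <= e + 3 -> e.+1 < (k - 1) * (k - 2) ->
  uniform k F -> {in F &, forall A B : {set 'I_n}, #|A :&: B| != 1} ->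
  #|F| = 'C(n - 2, k - 2) ->
  exists r, exists2 M : {set 'I_n}, r <= 1 /\ (r = 1 -> k = e + 3) &
    #|M| = 2 * r + 2 /\ F = frankl k r M.
Proof.
move=> nE k3 ke ek; have cT : #|'I_n| = 2 * k + e by rewrite card_ord.
have [m] := ubnP (weight F); elim: m F => // m IH F mF uF F1 cF.
have cF' : #|F| = 'C(#|'I_n| - 2, k - 2) by rewrite card_ord.
have [F2 bF] := tight_coclique cT k3 ke ek uF F1 cF'.
have [/existsP[A /andP[AF /existsP[j /existsP[i /and4P[jA iA ij sA]]]]]|ncomp] :=
  boolP [exists A in F, [exists j : 'I_n, [exists i : 'I_n,
    [&& j \in A, i \notin A, i < j & swap A j i \notin F]]]].
  (* The shifted family has smaller weight; the induction hypothesis identifies it, and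
     [frankl_of_shift] goes back to [F]. *)
  have F2s : two_intersecting (shift F j i) := two_intersecting_shift F2.
  have [r [M rM [cM sF]]] := IH _ (leq_trans (weight_shift AF jA iA ij sA) mF)
    (uniform_shift uF) (two_intersecting_neq1 F2s) (etrans (card_shift F j i) cF).
  have [M' cM' FE] := frankl_of_shift cT k3 ke ek cM uF F2 cF' sF.
  by exists r, M'.
have comp : compressed F.
  move=> A j i AF jA iA ij; apply: contraNT ncomp => sA.
  by apply/existsP; exists A; rewrite AF; apply/existsP; exists j; apply/existsP; exists i; apply/and4P.
have Fn0 : F != set0 by rewrite -card_gt0 cF bin_gt0 nE; move: k3; clear; lia.
have [r [M [r1 rk cM MF]]] := compressed_generators nE k3 ke uF F2 bF comp Fn0.
exists r, M => //; split=> //.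
have r2k : r + 2 <= k by apply: leq_trans k3; rewrite -[3]/(1 + 2) leq_add2r.
exact: (subset_frankl_eq cT k3 ke ek cM cF' (subset_frankl cT ke cM r2k uF F2 MF)).
Qed.

Lemma kset_family (n k : nat) (I : {set kset n k}) (S : kset n k) :
  (val S \in [set val X | X in I]) = (S \in I).
Proof. exact/mem_imset/val_inj. Qed.

Theorem theorem2 (k n : nat) (hk : 3 <= k) (I : {set kset n k})
    (hI : coclique (@J1 n k) I) (hcard : #|I| = 'C(n - 2, k - 2)) :
  (3 * k - 3 < n < k ^ 2 - k + 1 -> two_star I) /\
  (n = 3 * k - 3 ->
     two_star I \/
     exists2 T : {set 'I_n}, #|T| = 4 & I = meets_in_three k T).
Proof.
suff main : 3 * k - 3 <= n < k ^ 2 - k + 1 -> two_star I \/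
    (n = 3 * k - 3 /\ exists2 T : {set 'I_n}, #|T| = 4 & I = meets_in_three k T).
  split=> [/andP[n1 n2]|nE].
    by have [|//|[nE]] := main; [rewrite n2 ltnW | rewrite nE ltnn in n1].
  have [||[]] := main; [|by left|by right].
  (* For n = 3k - 3 the upper bound says (k - 2)^2 > 0. *)
  by rewrite nE leqnn /= -mulnn; move: hk; clear; nia.
case/andP=> n1 n2; have [e nE] : exists e, n = 2 * k + e.
  by exists (n - 2 * k); move: n1 hk; clear; lia.
have ke : k <= e + 3 by move: n1 hk; rewrite nE; clear; lia.
have ek : e.+1 < (k - 1) * (k - 2) by move: n2 hk; rewrite nE -mulnn; clear; nia.
pose F : {set {set 'I_n}} := [set val X | X in I].
have uF : uniform k F by move=> _ /imsetP[X _ ->]; apply/eqP/(valP X).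
have F1 : {in F &, forall A B : {set 'I_n}, #|A :&: B| != 1}.
  move=> _ _ /imsetP[X XI ->] /imsetP[Y YI ->].
  have [->|XY] := eqVneq X Y; last by have := hI X Y XI YI; rewrite /J1 XY.
  by rewrite setIid (eqP (valP Y)); move: hk; clear; lia.
have cF : #|F| = 'C(n - 2, k - 2) by rewrite card_imset //; apply: val_inj.
have [r [M [r1 rk] [cM FE]]] := tight_is_frankl nE hk ke ek uF F1 cF.
have IE (S : kset n k) : (S \in I) = (r + 2 <= #|val S :&: M|).
  by rewrite -kset_family -/F FE inE (valP S).
(* For r = 0, meeting the 2-set [M] in two points means containing it; for r = 1, k = e + 3 gives n
   = 3k - 3. *)
case: r r1 rk cM {FE} IE => [|[|//]] _ rk cM IE; [left | right].
  exists M => //; apply/setP => S; rewrite IE inE.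
  rewrite -cM; apply/idP/idP => [c|/setIidPr ->] //.
  by apply/setIidPr/eqP; rewrite eqEcard subsetIr.
split; first by rewrite nE (rk erefl); clear; lia.
by exists M => //; apply/setP => S; rewrite IE inE.
Qed.
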